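(* Let $i,j,k,l\in\mathbb N$ with $\{i,j,k,l\}=\{0,1,2,3\}$, and let $C\subset L^3_2$ be a tropical curve such that $$C\subset\mathrm{cone}([e_i],[e_j])\cup\mathrm{cone}([e_i],[e_k])\cup\mathrm{cone}([e_i],[e_l])$$ and $m_C(e_j)=m_C(e_k)=0$. Then $C$ can only be realizable in $L$ if $m_C(e_l)\ne1$.
   Context: Let $K$ be an algebraically closed field (of any characteristic), $S=K[x_0^{\pm1},\dots,x_3^{\pm1}]$, $S_0$ its degree-$0$ part, $X=\mathrm{Spec}(S_0)$ the $3$-dimensional torus, $L=(x_0+x_1+x_2+x_3)\subset S$, $L_0=L\cap S_0$, and $E=\mathrm{Spec}(S_0/L_0)$. In $\mathbb R^4/\langle\mathbf 1\rangle$, $\mathbf 1=(1,1,1,1)$, with lattice $\mathbb Z^4/\langle\mathbf 1\rangle$, write $[v]$ for the class of $v$ and $e_0,\dots,e_3$ for the unit vectors. $L^3_2=\mathrm{trop}(E)$ is the $2$-dimensional fan with maximal cones $\mathrm{cone}([e_i],[e_j])$, $i<j$, all of multiplicity $1$. A tropical curve in $L^3_2$ is a $1$-dimensional rational fan with support in $L^3_2$ and non-negative integer multiplicities $m(\sigma)$ on its rays with $\sum_\sigma m(\sigma)u_\sigma=0$, where $u_\sigma$ is the primitive lattice generator of $\sigma$. $m_C(e_i)$ denotes the multiplicity in $C$ of the ray spanned by $[e_i]$ ($0$ if this is not a ray of $C$). Tropicalization (trivial valuation, min-convention): for $f=\sum_\nu a_\nu x^\nu\in S_0$ and $\omega\in\mathbb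 R^4$ let $\mathrm{in}_\omega(f)$ be the sum of the terms $a_\nu x^\nu$, $a_\nu\ne0$, with $\omega\cdot\nu$ minimal; $\mathrm{in}_\omega(I)$ is the ideal generated by all $\mathrm{in}_\omega(f)$, $f\in I$. For an irreducible curve $Y\subset X$ with prime ideal $P\subset S_0$, $\mathrm{trop}(Y)\subset\mathbb R^4/\langle\mathbf 1\rangle$ is the image of $\{\omega:\mathrm{in}_\omega(P)\ne S_0\}$, with multiplicity $\sum_Q\ell((S_0/\mathrm{in}_\omega(P))_Q)$ on a ray $\sigma$, where $\omega$ is in the relative interior of $\sigma$ and $Q$ runs over the minimal primes of $\mathrm{in}_\omega(P)$. Extend this linearly to a map $\mathrm{Trop}$ on $1$-cycles. $C$ is realizable in $L$ if there is an effective $1$-cycle $Y$ in $E$ (a non-negative integer combination of irreducible curves in $E$) with $\mathrm{Trop}(Y)=C$. *)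

(* Defs.v *)
From HB Require Import structures.
From mathcomp Require Import all_boot all_order all_algebra finmap.
From mathcomp Require Import monalg.
From mathcomp Require Import boolp classical_sets reals.

Set Implicit Arguments.
Unset Strict Implicit.
Unset Printing Implicit Defensive.

Import Order.TTheory GRing.Theory Num.Theory.

Local Open Scope classical_set_scope.
Local Open Scope ring_scope.

(* The Laurent polynomial ring K[x_0^{+-1}, ..., x_(n-1)^{+-1}]: finitely
   supported coefficient functions on Z^n with the convolution product.  The ring
   structure that monalg puts on {malg K[M]} is not available here, because its
   monoids M are required to have no invertible element besides 1. *)
Definition laurent (K : comNzRingType) (n : nat) : Type :=
  {malg K['rV[int]_n]}.

Section LaurentRing.
Variables (K : comNzRingType) (n : nat).
Local Notation M := 'rV[int]_n.
Local Notation S := {malg K[M]}.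
Implicit Types (f g h : S) (k : M) (c : K).

Definition lone : S := << 1 *g 0 >>.

Definition lmul f g : S :=
  \sum_(k1 <- msupp f) \sum_(k2 <- msupp g) << f@_k1 * g@_k2 *g (k1 + k2) >>.

Lemma lmulw (d1 d2 : {fset M}) f g :
  (msupp f `<=` d1)%fset -> (msupp g `<=` d2)%fset ->
  lmul f g = \sum_(k1 <- d1) \sum_(k2 <- d2) << f@_k1 * g@_k2 *g (k1 + k2) >>.
Proof.
move=> le_d1 le_d2; rewrite /lmul (big_fset_incl _ le_d1) /=.
  apply/eq_bigr=> k1 _; apply/big_fset_incl => // k _ /mcoeff_outdom ->.
  by rewrite mulr0 monalgU0.
move=> k _ /mcoeff_outdom fk.
by rewrite big1 => // k' _; rewrite fk mul0r monalgU0.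
Qed.

Lemma lmulC : commutative lmul.
Proof.
move=> f g; rewrite /lmul exchange_big /=.
apply: eq_bigr => k1 _; apply: eq_bigr => k2 _.
by rewrite mulrC addrC.
Qed.

Lemma lmul0g : left_zero 0 lmul.
Proof. by move=> g; rewrite /lmul msupp0 big_seq_fset0. Qed.

Lemma lmulUg c k g :
  lmul << c *g k >> g = \sum_(k' <- msupp g) << c * g@_k' *g (k + k') >>.
Proof.
rewrite (lmulw msuppU_le (fsubset_refl _)) big_seq_fset1.
by apply/eq_bigr => k' _; rewrite mcoeffUU.
Qed.

Lemma lmulUU c1 c2 k1 k2 :
  lmul << c1 *g k1 >> << c2 *g k2 >> = << c1 * c2 *g (k1 + k2) >>.
Proof. by rewrite (lmulw msuppU_le msuppU_le) !big_seq_fset1 !mcoeffUU. Qed.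

Lemma lmul1g : left_id lone lmul.
Proof.
move=> g; rewrite lmulUg [RHS]monalgE.
by apply/eq_bigr=> kg _; rewrite mul1r add0r.
Qed.

Lemma lmulDl : left_distributive lmul +%R.
Proof.
move=> f1 f2 g.
rewrite [in RHS](lmulw (fsubsetUl _ (msupp f2)) (fsubset_refl _)).
rewrite [in RHS](lmulw (fsubsetUr (msupp f1) _) (fsubset_refl _)).
rewrite (lmulw (msuppD_le _ _) (fsubset_refl _)) -big_split /=.
apply/eq_bigr=> k1 _; rewrite -big_split /=; apply/eq_bigr=> k2 _.
by rewrite mcoeffD mulrDl monalgUD.
Qed.

Lemma lmulDr : right_distributive lmul +%R.
Proof. by move=> f g h; rewrite lmulC lmulDl !(lmulC _ f). Qed.

Lemma lmulg0 : right_zero 0 lmul.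
Proof. by move=> f; rewrite lmulC lmul0g. Qed.

Lemma lmulEl1 f g :
  lmul f g = \sum_(k1 <- msupp f) lmul << f@_k1 *g k1 >> g.
Proof. by apply/eq_bigr=> k _; rewrite lmulUg. Qed.

Lemma lmulEr1 f g :
  lmul f g = \sum_(k2 <- msupp g) lmul f << g@_k2 *g k2 >>.
Proof. by rewrite lmulC lmulEl1; apply: eq_bigr => k _; rewrite lmulC. Qed.

Lemma lmulA : associative lmul.
Proof.
move=> f g h.
rewrite [RHS](big_morph (lmul^~ _) (fun _ _ => lmulDl _ _ _) (lmul0g _)).
rewrite lmulEl1; apply/eq_bigr=> k1 _.
rewrite [LHS](big_morph (lmul _) (fun _ _ => lmulDr _ _ _) (lmulg0 _)).
rewrite [RHS](big_morph (lmul^~ _) (fun _ _ => lmulDl _ _ _) (lmul0g _)).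
apply/eq_bigr=> k2 _.
rewrite [LHS](big_morph (lmul _) (fun _ _ => lmulDr _ _ _) (lmulg0 _)).
by rewrite lmulEr1; apply/eq_bigr=> k3 _; rewrite !lmulUU mulrA addrA.
Qed.

Lemma lone_neq0 : lone != 0.
Proof. by rewrite monalgU_eq0 oner_eq0. Qed.

HB.instance Definition _ := GRing.Lmodule.copy (laurent K n) {malg K[M]}.
HB.instance Definition _ := GRing.Zmodule_isComNzRing.Build (laurent K n)
  lmulA lmulC lmul1g lmulDl lone_neq0.

End LaurentRing.

Definition monom (K : comNzRingType) n (nu : 'rV[int]_n) : laurent K n :=
  << 1 *g nu >>.

Definition Xvar (K : comNzRingType) n (i : 'I_n) : laurent K n :=
  monom K (delta_mx 0 i).

Section DegreeZero.
Variables (K : comNzRingType) (n : nat).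

Definition degree (nu : 'rV[int]_n) : int := \sum_(i < n) nu 0 i.

Definition deg0 : {pred laurent K n} :=
  [pred f : laurent K n | all (fun nu => degree nu == 0) (msupp f)].

Lemma degreeD nu mu : degree (nu + mu) = degree nu + degree mu.
Proof. by rewrite -big_split; apply: eq_bigr => i _; rewrite mxE. Qed.

Lemma deg0P (f : laurent K n) :
  reflect (forall nu, degree nu != 0 -> f@_nu = 0) (f \in deg0).
Proof.
apply: (iffP allP) => [h nu nu0 | h nu].
  by apply: mcoeff_outdom; apply: contra nu0; apply: h.
by rewrite -mcoeff_neq0; apply: contra_neqT => nu0; apply: h.
Qed.

Lemma deg0_subring : subring_closed deg0.
Proof.
split=> [|f g /deg0P hf /deg0P hg|f g /allP hf /allP hg].
- apply/deg0P => nu nu0; change ((lone K n)@_nu = 0); rewrite /lone mcoeffU.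
  case: eqP => // nuE; case/negP: nu0.
  by rewrite -nuE /degree big1 // => i _; rewrite mxE.
- by apply/deg0P => nu nu0; rewrite mcoeffB hf // hg // subr0.
- apply/deg0P => nu nu0.
  change ((lmul f g)@_nu = 0).
  rewrite /lmul raddf_sum big_seq big1 //= => k1 k1f.
  rewrite raddf_sum big_seq big1 //= => k2 k2g.
  rewrite mcoeffU; case: eqP => // kE; case/negP: nu0.
  by rewrite -kE degreeD (eqP (hf _ k1f)) (eqP (hg _ k2g)).
Qed.
HB.instance Definition _ :=
  GRing.isSubringClosed.Build (laurent K n) deg0 deg0_subring.

Record laurent0 : Type :=
  Laurent0 { laurent0_val :> laurent K n; _ : laurent0_val \in deg0 }.
HB.instance Definition _ := [isSub for laurent0_val].
HB.instance Definition _ := [Choice of laurent0 by <:].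
HB.instance Definition _ := [SubChoice_isSubComNzRing of laurent0 by <:].

End DegreeZero.

Section Ideals.
Variable A : comNzRingType.
Implicit Types (I P Q : set A).

(* The library's idealr is reserved to proper ideals; the unit ideal is needed
   here. *)
Definition is_ideal I : Prop :=
  [/\ I 0, (forall a b, I a -> I b -> I (a + b))
    & forall a b, I b -> I (a * b)].

Definition ideal_gen (G : set A) : set A := smallest is_ideal G.

Definition prime_ideal P : Prop :=
  [/\ is_ideal P, ~ P 1 & forall a b, P (a * b) -> P a \/ P b].

Definition minimal_prime I Q : Prop :=
  [/\ prime_ideal Q, I `<=` Q
    & forall Q', prime_ideal Q' -> I `<=` Q' -> Q' `<=` Q -> Q' = Q].

End Ideals.

Definition strict_chain (T : Type) (F : set (set T)) (n : nat)
    (c : nat -> set T) : Prop :=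
  (forall i, (i <= n)%N -> F (c i)) /\
  (forall i, (i < n)%N -> c i `<` c i.+1).

Definition max_chain_length (T : Type) (F : set (set T)) (n : nat) : Prop :=
  (exists c, strict_chain F n c) /\ ~ (exists c, strict_chain F n.+1 c).

(* Primes of A/P are the primes of A containing P. *)
Definition krull_dim_quotient (A : comNzRingType) (P : set A) (n : nat) : Prop :=
  max_chain_length [set Q | prime_ideal Q /\ P `<=` Q] n.

(* The local ring (A/I)_Q, for an ideal I contained in a prime Q: its elements
   are the fractions a/s with s outside Q, encoded as pairs (a, s), up to the
   equivalence loc_eq. *)
Section LocalLength.
Variables (A : comNzRingType) (I Q : set A).
Implicit Types (x y : A * A).

Definition loc_frac : set (A * A) := [set x | ~ Q x.2].

Definition loc_eq x y : Prop :=
  exists2 u, ~ Q u & I (u * (x.1 * y.2 - y.1 * x.2)).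

Definition loc_zero : A * A := (0, 1).
Definition loc_add x y : A * A := (x.1 * y.2 + y.1 * x.2, x.2 * y.2).
Definition loc_mul x y : A * A := (x.1 * y.1, x.2 * y.2).

Definition loc_ideal (J : set (A * A)) : Prop :=
  [/\ J `<=` loc_frac,
      forall x y, J x -> loc_frac y -> loc_eq x y -> J y,
      J loc_zero,
      forall x y, J x -> J y -> J (loc_add x y)
    & forall x y, loc_frac x -> J y -> J (loc_mul x y)].

(* The length of (A/I)_Q as a module over itself is n. *)
Definition local_length (n : nat) : Prop := max_chain_length loc_ideal n.

End LocalLength.

(* A^4 / <(1,1,1,1)>, used for A = Z and A = R. *)
Section ModOnes.
Variable A : comNzRingType.

Definition ones : {pred 'rV[A]_4} := [pred v : 'rV[A]_4 | v == const_mx (v 0 0)].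

Lemma ones_submod : submod_closed ones.
Proof.
split=> [|a u v /eqP -> /eqP ->]; rewrite inE; apply/eqP/rowP => i.
  by rewrite !mxE.
by rewrite !mxE.
Qed.
HB.instance Definition _ := GRing.isSubmodClosed.Build A 'rV[A]_4 ones ones_submod.

Definition modones : Type := {ideal_quot ones}.
HB.instance Definition _ := GRing.Zmodule.copy modones {ideal_quot ones}.
HB.instance Definition _ := EqQuotient.copy modones {ideal_quot ones}.

Definition cls (v : 'rV[A]_4) : modones := (\pi_modones v)%qT.


Lemma clsP u v : (u - v \in ones) = (cls u == cls v).
Proof. exact: Quotient.idealrBE. Qed.

Lemma clsD u v : cls (u + v) = cls u + cls v.
Proof. exact: (raddfD (\pi_{ideal_quot ones})%qT). Qed.

Lemma clsK x : cls (repr x) = x.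
Proof. exact: reprK. Qed.

Definition scale_modones (a : A) (x : modones) : modones := cls (a *: repr x).

Lemma scale_cls a v : scale_modones a (cls v) = cls (a *: v).
Proof.
apply/eqP; rewrite -clsP -scalerBr; apply: rpredZ.
by rewrite clsP clsK.
Qed.

Lemma scale_modonesA a b x :
  scale_modones a (scale_modones b x) = scale_modones (a * b) x.
Proof. by rewrite -[x]clsK !scale_cls scalerA. Qed.

Lemma scale_modones1 : left_id 1 scale_modones.
Proof. by move=> x; rewrite -[x]clsK scale_cls scale1r. Qed.

Lemma scale_modonesDr : right_distributive scale_modones +%R.
Proof.
move=> a x y; rewrite -[x]clsK -[y]clsK -clsD !scale_cls.
by rewrite scalerDr clsD.
Qed.

Lemma scale_modonesDl x : {morph scale_modones^~ x : a b / a + b}.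
Proof. by move=> a b; rewrite -[x]clsK !scale_cls scalerDl clsD. Qed.

HB.instance Definition _ := GRing.Zmodule_isLmodule.Build A modones
  scale_modonesA scale_modones1 scale_modonesDr scale_modonesDl.

Definition unit_class (i : 'I_4) : modones := cls (delta_mx 0 i).

End ModOnes.

Arguments unit_class : clear implicits.

Section Fan.
Variable R : realType.
Local Notation V := (modones R).
Local Notation N := (modones int).

Definition real_class (u : N) : V := cls (map_mx intr (repr u)).

Definition primitive (u : N) : Prop :=
  forall (w : N) (d : nat), u = w *+ d -> d = 1%N.

(* Rational rays are represented by their primitive lattice generators. *)
Definition ray (u : N) : set V :=
  [set x | exists2 t : R, 0 <= t & x = t *: real_class u].

Definition ray_relint (u : N) : set V :=
  [set x | exists2 t : R, 0 < t & x = t *: real_class u].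

Definition cone (v w : V) : set V :=
  [set x | exists a b : R, [/\ 0 <= a, 0 <= b & x = a *: v + b *: w]].

Definition L32 : set V :=
  [set x | exists i j : 'I_4,
     (i < j)%N /\ cone (unit_class R i) (unit_class R j) x].

Record tropical_curve := TropicalCurve {
  rays : {fset N};
  weight : N -> nat;
  rays_primitive : forall u, u \in rays -> primitive u;
  rays_in_L32 : forall u, u \in rays -> ray u `<=` L32;
  balanced : \sum_(u <- rays) u *+ weight u = 0 }.

Definition curve_support (C : tropical_curve) : set V :=
  [set x | exists2 u, u \in rays C & ray u x].

Definition mult (C : tropical_curve) (u : N) : nat :=
  if u \in rays C then weight C u else 0%N.

End Fan.

Section Tropicalization.
Variables (R : realType) (K : closedFieldType).
Local Notation S := (laurent K 4).
Local Notation S0 := (laurent0 K 4).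
Local Notation N := (modones int).
Implicit Types (omega : 'rV[R]_4) (P : set S0).

Definition dot omega (nu : 'rV[int]_4) : R :=
  \sum_(i < 4) omega 0 i * (nu 0 i)%:~R.

Definition init_form omega (f : S) : S :=
  \sum_(nu <- msupp f | all (fun mu => dot omega nu <= dot omega mu) (msupp f))
     << f@_nu *g nu >>.

Lemma init_form_deg0 omega (f : S0) : init_form omega f \in @deg0 K 4.
Proof.
case: f => f /= /allP f0; apply/deg0P => nu nu0.
rewrite /init_form raddf_sum big_seq_cond big1 //= => mu /andP[muf _].
rewrite mcoeffU; case: eqP => // muE; case/negP: nu0.
by rewrite -muE; apply: f0.
Qed.

Definition init0 omega (f : S0) : S0 := Laurent0 (init_form_deg0 omega f).

Definition init_ideal omega P : set S0 :=
  ideal_gen [set init0 omega f | f in P].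

(* The multiplicity in trop(Y) of the ray spanned by u, where Y has prime ideal P.
   If the ray is not part of trop(Y), then init_ideal omega P is the unit ideal,
   which has no minimal primes, and the multiplicity is 0. *)
Definition curve_trop_mult P (u : N) (m : nat) : Prop :=
  forall omega, ray_relint u (cls omega) ->
  exists (Qs : seq (set S0)) (len : set S0 -> nat),
    [/\ uniq Qs,
        forall Q, Q \in Qs <-> minimal_prime (init_ideal omega P) Q,
        forall Q, Q \in Qs -> local_length (init_ideal omega P) Q (len Q)
      & m = (\sum_(Q <- Qs) len Q)%N].

Definition L : set S := ideal_gen [set \sum_(i < 4) Xvar K i].

Definition L0 : set S0 := [set f | L (val f)].

Definition curve_in_E P : Prop :=
  [/\ prime_ideal P, L0 `<=` P & krull_dim_quotient P 1].

Record effective_cycle := EffectiveCycle {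
  ncomp : nat;
  coef : 'I_ncomp -> nat;
  comp : 'I_ncomp -> set S0;
  comp_curve : forall a, curve_in_E (comp a) }.

Definition cycle_trop_mult (Y : effective_cycle) (u : N) (m : nat) : Prop :=
  exists2 mu : 'I_(ncomp Y) -> nat,
    forall a, curve_trop_mult (comp a) u (mu a)
  & m = (\sum_a coef a * mu a)%N.

Definition realizable (C : tropical_curve R) : Prop :=
  exists Y : effective_cycle,
    forall u, primitive u -> cycle_trop_mult Y u (mult C u).

End Tropicalization.

Arguments realizable {R} K C.

(* Main.v *)
(* Setting x_i = 1 identifies E with the affine plane, with coordinates
   x = x_j, y = x_k and x_l = - 1 - x - y, minus the three lines where a coordinate
   vanishes.  One component of the cycle, with prime ideal P, has multiplicity 1
   along [e_l], and its multiplicities along [e_j], [e_k] and in the interior of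
   the cones that do not contain [e_i] vanish.  The prime P restricts to a prime of
   K[x, y], and the only case that matters is the one of a principal ideal (f).
   If f vanished at a vertex of the triangle of lines, an edge of its Newton polygon
   there would give a ray inside a forbidden cone; and f has no zero on the lines
   x = 0 and y = 0 off the vertices.  So f is constant on these two lines, with the
   same nonzero value f(0, 0).  On the third line h(x) = f(x, - 1 - x) then satisfies
   h(0) = h(-1), hence has degree different from 1, whereas the multiplicity along
   [e_l] can only be 1 if h has degree 1.
   Initial ideals are controlled by substituting x_m = T^(w_m) U_m with U_m a unit
   at T = 0, and letting T tend to 0. *)

Require Import Defs.
From HB Require Import structures.
From mathcomp Require Import all_boot all_order all_algebra finmap.
From mathcomp Require Import monalg.
From mathcomp Require Import boolp classical_sets reals.
From mathcomp Require Import ring zify.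

Set Implicit Arguments.
Unset Strict Implicit.
Unset Printing Implicit Defensive.

Import Order.TTheory GRing.Theory Num.Theory.

Local Open Scope classical_set_scope.
Local Open Scope ring_scope.

Section Eval2.
Variables (K B : comNzRingType) (c : {rmorphism K -> B}) (a b : B).

Lemma commr_rmorph_com (R : nzRingType) (f : R -> B) u : commr_rmorph f u.
Proof. by move=> x; apply: mulrC. Qed.

Definition eval2 : {poly {poly K}} -> B :=
  horner_morph (commr_rmorph_com (horner_morph (commr_rmorph_com c b)) a).

HB.instance Definition _ := GRing.RMorphism.on eval2.

Lemma eval2C k : eval2 k%:P%:P = c k.
Proof. by rewrite /eval2 horner_morphC /= horner_morphC. Qed.

Lemma eval2X : eval2 'X = a.
Proof. by rewrite /eval2 horner_morphX. Qed.

Lemma eval2Y : eval2 'X%:P = b.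
Proof. by rewrite /eval2 horner_morphC /= horner_morphX. Qed.

Lemma eval2N f : eval2 (- f) = - eval2 f.
Proof. exact: (rmorphN [the {rmorphism {poly {poly K}} -> B} of eval2]). Qed.

Lemma eval2B f g : eval2 (f - g) = eval2 f - eval2 g.
Proof. exact: (rmorphB [the {rmorphism {poly {poly K}} -> B} of eval2]). Qed.

End Eval2.

Lemma poly2_ind (K : comNzRingType) (Pr : {poly {poly K}} -> Prop) :
  (forall k, Pr k%:P%:P) -> Pr 'X -> Pr 'X%:P ->
  (forall f g, Pr f -> Pr g -> Pr (f + g)) ->
  (forall f g, Pr f -> Pr g -> Pr (f * g)) -> forall f, Pr f.
Proof.
move=> PC PX PY PD PM.
have PCC q : Pr q%:P.
  elim/poly_ind: q => [|q k Pq]; first by have := PC 0.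
  by rewrite polyCD polyCM; apply: PD => //; apply: PM.
elim/poly_ind => [|q k Pq]; first by have := PC 0; rewrite !polyC0.
by apply: PD => //; apply: PM.
Qed.

Lemma rmorph_eval2 (K B D : comNzRingType) (c : {rmorphism K -> B}) (a b : B)
    (c' : {rmorphism K -> D}) (s : {rmorphism B -> D}) f :
  s \o c =1 c' -> s (eval2 c a b f) = eval2 c' (s a) (s b) f.
Proof.
move=> sc; elim/poly2_ind: f => [k|||f g ef eg|f g ef eg].
- by rewrite !eval2C -sc.
- by rewrite !eval2X.
- by rewrite !eval2Y.
- by rewrite !rmorphD /= ef eg.
- by rewrite !rmorphM /= ef eg.
Qed.

Definition polyCC (K : comNzRingType) : K -> {poly {poly K}} := polyC \o polyC.
HB.instance Definition _ K := GRing.RMorphism.on (@polyCC K).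

Lemma eval2_id (K : comNzRingType) f : eval2 (@polyCC K) 'X 'X%:P f = f.
Proof.
elim/poly2_ind: f => [k|||f g ef eg|f g ef eg].
- by rewrite eval2C.
- by rewrite eval2X.
- by rewrite eval2Y.
- by rewrite rmorphD /= ef eg.
- by rewrite rmorphM /= ef eg.
Qed.

(** * Ideals and lengths *)

Section IdealFacts.
Variable A : comNzRingType.
Implicit Types I P Q : set A.

Lemma ideal_zero I : is_ideal I -> I 0. Proof. by case. Qed.

Lemma ideal_add I a b : is_ideal I -> I a -> I b -> I (a + b).
Proof. by case=> _ h _; apply: h. Qed.

Lemma ideal_mull I a b : is_ideal I -> I b -> I (a * b).
Proof. by case=> _ _; apply. Qed.

Lemma ideal_mulr I a b : is_ideal I -> I a -> I (a * b).
Proof. by rewrite mulrC; apply: ideal_mull. Qed.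

Lemma ideal_opp I a : is_ideal I -> I a -> I (- a).
Proof. by rewrite -mulN1r; apply: ideal_mull. Qed.

Lemma ideal_sub I a b : is_ideal I -> I a -> I b -> I (a - b).
Proof. by move=> iI Ia Ib; apply: ideal_add => //; apply: ideal_opp. Qed.

Lemma ideal_subr I a b : is_ideal I -> I (a - b) -> I b -> I a.
Proof. by move=> iI Iab Ib; rewrite -(subrK b a); apply: ideal_add. Qed.

Lemma ideal_subl I a b : is_ideal I -> I (a - b) -> I a -> I b.
Proof. by move=> iI Iab Ib; rewrite -(subKr a b); apply: ideal_sub. Qed.

Lemma ideal_congrM I a b a' b' : is_ideal I ->
  I (a - a') -> I (b - b') -> I (a * b - a' * b').
Proof.
move=> iI Ia Ib.
have -> : a * b - a' * b' = b * (a - a') + a' * (b - b') by ring.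
by apply: ideal_add => //; apply: ideal_mull.
Qed.

Lemma ideal_congrD I a b a' b' : is_ideal I ->
  I (a - a') -> I (b - b') -> I (a + b - (a' + b')).
Proof. by move=> iI Ia Ib; rewrite opprD addrACA; apply: ideal_add. Qed.

Lemma ideal_genP (G : set A) : is_ideal (ideal_gen G).
Proof.
split=> [B [[]] //|a b Ia Ib B hB|a b Ib B hB].
  by case: (hB) => iB _; apply: ideal_add => //; [apply: Ia|apply: Ib].
by case: (hB) => iB _; apply: ideal_mull => //; apply: Ib.
Qed.

Lemma ideal_gen_sub (G : set A) I : is_ideal I -> G `<=` I -> ideal_gen G `<=` I.
Proof. by move=> iI GI; apply: smallest_sub. Qed.

Lemma mem_ideal_gen (G : set A) : G `<=` ideal_gen G.
Proof. exact: sub_gen_smallest. Qed.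

Lemma prime_idealX P a n : prime_ideal P -> P (a ^+ n) -> P a.
Proof.
move=> [iP P1 PM]; elim: n => [/P1//|n IH]; rewrite exprS.
by case/PM.
Qed.

Lemma prime_idealM P a b : prime_ideal P -> P (a * b) -> ~ P b -> P a.
Proof. by move=> [iP P1 PM] /PM[]. Qed.

Lemma prime_unit P a b : prime_ideal P -> a * b = 1 -> ~ P a.
Proof. by move=> [iP P1 _] ab /(ideal_mulr b iP); rewrite ab. Qed.

Lemma prime_ker (E : fieldType) (s : {rmorphism A -> E}) :
  prime_ideal [set a | s a = 0].
Proof.
split=> /=; last by move=> a b; rewrite rmorphM => /eqP; rewrite mulf_eq0;
  case/orP => /eqP; [left|right].
  split=> /=; first by rewrite rmorph0.
    by move=> a b sa sb; rewrite rmorphD sa sb addr0.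
  by move=> a b sb; rewrite rmorphM sb mulr0.
by rewrite rmorph1; apply/eqP/oner_neq0.
Qed.

Lemma chain_prime_bigcap (F : set (set A)) :
  F !=set0 -> (forall P, F P -> prime_ideal P) ->
  total_on F (fun P Q => P `<=` Q) ->
  prime_ideal (\bigcap_(P in F) P).
Proof.
move=> [P0 FP0] prF totF; split.
- split=> [P /prF[] [] //|a b ha hb P FP|a b hb P FP].
    by have [iP _ _] := prF P FP; apply: ideal_add (ha _ FP) (hb _ FP).
  by have [iP _ _] := prF P FP; apply: ideal_mull (hb _ FP).
- by move=> /(_ P0 FP0); have [] := prF P0 FP0.
- move=> a b hab; apply: contrapT => /not_orP[]; rewrite /bigcap /=.
  move=> /existsNP[P] /not_implyP[FP Pa] /existsNP[Q] /not_implyP[FQ Qb].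
  have [PQ|QP] := totF P Q FP FQ.
    have [_ _ PM] := prF P FP.
    by case: (PM a b (hab P FP)) => // /PQ.
  have [_ _ PM] := prF Q FQ.
  by case: (PM a b (hab Q FQ)) => // /QP.
Qed.

Lemma minimal_prime_exists I Q0 : prime_ideal Q0 -> I `<=` Q0 ->
  exists2 Q, minimal_prime I Q & Q `<=` Q0.
Proof.
move=> prQ0 IQ0.
pose T := {Q : set A | [/\ prime_ideal Q, I `<=` Q & Q `<=` Q0]}.
pose Rel (x y : T) : bool := `[< sval y `<=` sval x >].
have [| | | |[Q hQ] Qmax] := @Zorn T Rel.
- by move=> x; apply/asboolP.
- by move=> x y z /asboolP h /asboolP h'; apply/asboolP; apply: subset_trans h' h.
- move=> [x hx] [y hy] /asboolP /= h /asboolP /= h'.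
  by apply: eq_exist; apply/seteqP.
- move=> F totF; have [[x0 Fx0]|/set0P/negP] := pselect (F !=set0); last first.
    rewrite negbK => /eqP ->; exists (exist _ Q0 (And3 prQ0 IQ0 (@subset_refl _ Q0))).
    by move=> s.
  have prB : prime_ideal (\bigcap_(P in [set sval x | x in F]) P).
    apply: chain_prime_bigcap => //.
    + by exists (sval x0); exists x0.
    + by move=> _ [[P [prP ? ?]] _ <-].
    + move=> _ _ [x Fx <-] [y Fy <-].
      by case: (totF x y Fx Fy) => /asboolP; [right|left].
  have IB : I `<=` \bigcap_(P in [set sval x | x in F]) P.
    by move=> a Ia _ [[P [prP IP ?]] _ <-]; apply: IP.
  have BQ : \bigcap_(P in [set sval x | x in F]) P `<=` Q0.
    move=> a /(_ (sval x0)) h.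
    have [_ _ sx0] := svalP x0; apply: sx0; apply: h.
    by exists x0.
  exists (exist _ (\bigcap_(P in [set sval x | x in F]) P) (And3 prB IB BQ)) => s Fs.
  apply/asboolP => a /=.
  by apply; exists s.
- have [prQ IQ QQ0] := hQ; exists Q => //; split=> // Q' prQ' IQ' Q'Q.
  have h : [/\ prime_ideal Q', I `<=` Q' & Q' `<=` Q0].
    by split=> //; apply: subset_trans QQ0.
  have := Qmax (exist _ Q' h); rewrite /Rel asboolE /= => /(_ Q'Q) e.
  by have [] := e.
Qed.

End IdealFacts.

Section Length.
Variables (A : comNzRingType) (I Q : set A).
Hypotheses (iI : is_ideal I) (prQ : prime_ideal Q) (IQ : I `<=` Q).

(* The extension to (A/I)_Q of an ideal [J] of [A]. *)
Definition loc_ext (J : set A) : set (A * A) :=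
  [set x | ~ Q x.2 /\ exists2 u, ~ Q u & J (u * x.1)].

Let nQM u v : ~ Q u -> ~ Q v -> ~ Q (u * v).
Proof. by case: prQ => _ _ h nu nv /h[]. Qed.

Let nQ1 : ~ Q 1. Proof. by case: prQ. Qed.

Lemma loc_ext_ideal J : is_ideal J -> I `<=` J -> loc_ideal I Q (loc_ext J).
Proof.
move=> iJ IJ; split.
- by move=> x [].
- move=> [a s] [b t] [/= sQ [v vQ Jva]] tQ [u uQ /= Iu]; split=> //=.
  exists (u * v * s); first by do 2?apply: nQM.
  have -> : u * v * s * b = u * t * (v * a) - v * (u * (a * t - b * s)) by ring.
  by apply: ideal_sub => //; apply: ideal_mull => //; apply: IJ.
- by split=> //=; exists 1 => //; rewrite mulr0; apply: ideal_zero.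
- move=> [a s] [b t] [/= sQ [u uQ Ja]] [/= tQ [v vQ Jb]]; split=> /=.
    exact: nQM.
  exists (u * v); first exact: nQM.
  have -> : u * v * (a * t + b * s) = v * t * (u * a) + u * s * (v * b) by ring.
  by apply: ideal_add => //; apply: ideal_mull.
- move=> [a s] [b t] /= sQ [/= tQ [u uQ Jb]]; split=> /=; first exact: nQM.
  exists u => //; have -> : u * (a * b) = a * (u * b) by ring.
  exact: ideal_mull.
Qed.

Let ideal_setT : is_ideal (@setT A). Proof. by []. Qed.

Lemma local_length_gt0 n : local_length I Q n -> (0 < n)%N.
Proof.
case: n => // -[_ []].
exists (fun i => loc_ext (if i is 0 then I else setT)); split=> [i _|[|//] _].
  by apply: loc_ext_ideal; case: i.
split=> [x [xQ [u uQ _]]|]; first by split=> //; exists u.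
move=> /(_ (1, 1))[].
  by split=> //=; exists 1.
by move=> _ [u uQ /=]; rewrite mulr1 => /IQ.
Qed.

Lemma local_length_gt1 n a : Q a -> (forall u, I (u * a) -> Q u) ->
  local_length I Q n -> (1 < n)%N.
Proof.
move=> Qa Ia len; have := local_length_gt0 len.
case: n len => // -[|//] [_ []].
have [iQ _ _] := prQ.
exists (fun i => loc_ext (match i with 0 => I | 1 => Q | _ => setT end)).
split=> [[|[|i]] _|[|[|//]] _]; try exact: loc_ext_ideal.
- split=> [x [xQ [u uQ Iu]]|]; first by split=> //; exists u => //; apply: IQ.
  move=> /(_ (a, 1))[].
    by split=> //=; exists 1 => //; rewrite mul1r.
  by move=> _ [u uQ /= /Ia].
- split=> [x [xQ [u uQ _]]|]; first by split=> //; exists u.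
  move=> /(_ (1, 1))[].
    by split=> //=; exists 1.
  by move=> _ [u uQ /=]; rewrite mulr1.
Qed.

End Length.

(** * Primes of the affine plane *)

Section PlanePrimes.
Variable K : closedFieldType.

Lemma prime_poly_root (B : comNzRingType) (s : {rmorphism {poly K} -> B})
    (P : set B) d :
  prime_ideal P -> d != 0 -> P (s d) -> exists b, P (s ('X - b%:P)).
Proof.
move=> prP; have [iP P1 PM] := prP.
have [n] := ubnP (size d); elim: n d => // n IH d ltn d0 Pd.
have [/eqP/size_poly1P[c c0 dE]|/closed_rootP[b /factor_theorem[q dE]]] :=
  eqVneq (size d) 1%N.
  case: (prime_unit (a := s d) (b := s c^-1%:P) prP _ Pd).
  by rewrite dE -rmorphM -polyCM mulfV // polyC1 rmorph1.
move: Pd; rewrite dE rmorphM => /PM[Pq|]; last by exists b.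
have q0 : q != 0 by apply: contra_neq d0 => q0; rewrite dE q0 mul0r.
apply: IH Pq => //; rewrite dE size_mul ?polyXsubC_eq0 // size_XsubC addn2 in ltn.
exact: ltn.
Qed.

Definition inner_eval (b : K) : {poly {poly K}} -> {poly K} :=
  map_poly (horner_eval b).
HB.instance Definition _ b := GRing.RMorphism.on (inner_eval b).

Lemma inner_evalC b q : inner_eval b q%:P = q.[b]%:P.
Proof. by rewrite /inner_eval map_polyC. Qed.

Lemma inner_evalB b f g : inner_eval b (f - g) = inner_eval b f - inner_eval b g.
Proof. exact: rmorphB. Qed.

Lemma inner_evalX b : inner_eval b 'X = 'X.
Proof. exact: map_polyX. Qed.

Lemma inner_factor b f : inner_eval b f = 0 ->
  exists g, f = ('X - b%:P)%:P * g.
Proof.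
move=> f0; exists (\poly_(i < size f) (f`_i %/ ('X - b%:P))).
apply/polyP => i; rewrite coefCM coef_poly; case: ltnP => [_|/leq_sizeP-> //].
  rewrite mulrC divpK // dvdp_XsubCl; apply/rootP.
  by have := congr1 (fun p : {poly K} => p`_i) f0; rewrite coef0 coef_map.
by rewrite mulr0.
Qed.

Lemma inner_primitive_dvd (d : {poly K}) g q f :
  (forall b, inner_eval b f != 0) -> d != 0 -> d%:P * g = q * f ->
  exists q', g = q' * f.
Proof.
move=> f0; have [n] := ubnP (size d); elim: n d q => // n IH d q ltn d0 E.
have [/eqP/size_poly1P[c c0 dE]|/closed_rootP[b /factor_theorem[d' dE]]] :=
  eqVneq (size d) 1%N.
  exists (c^-1%:P%:P * q); rewrite -mulrA -E dE mulrA -!polyCM mulVf //.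
  by rewrite !polyC1 mul1r.
have : inner_eval b q = 0.
  have := congr1 (inner_eval b) E; rewrite !rmorphM /= inner_evalC dE hornerM.
  rewrite hornerXsubC subrr mulr0 polyC0 mul0r => /esym/eqP.
  by rewrite mulf_eq0 (negPf (f0 b)) orbF => /eqP.
case/inner_factor => q' qE.
have d'0 : d' != 0 by apply: contra_neq d0 => d0; rewrite dE d0 mul0r.
apply: (IH d' q') => //.
  rewrite dE size_mul ?polyXsubC_eq0 // size_XsubC addn2 in ltn.
  exact: ltn.
have /mulfI : ('X - b%:P)%:P != 0 :> {poly {poly K}}.
  by rewrite polyC_eq0 polyXsubC_eq0.
by apply; rewrite !mulrA -qE -E dE polyCM [_ * d'%:P]mulrC.
Qed.

Lemma plane_prime (P : set {poly {poly K}}) : prime_ideal P ->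
  [\/ forall g, P g -> g = 0,
      exists2 f, f != 0 /\ P f & forall g, P g -> exists q, g = q * f
    | exists a b, P ('X - a%:P%:P) /\ P ('X - b%:P)%:P].
Proof.
move=> prP; have [iP P1 PM] := prP.
have [[d [d0 Pd]]|noC] := pselect (exists d : {poly K}, d != 0 /\ P d%:P).
  have [b Pb] := prime_poly_root (s := polyC) prP d0 Pd.
  have [all0|/existsNP[g /not_implyP[Pg gb]]] :=
    pselect (forall g, P g -> inner_eval b g = 0).
    apply: Or32; exists ('X - b%:P)%:P; first by rewrite polyC_eq0 polyXsubC_eq0.
    move=> g /all0/inner_factor[q ->]; exists q; exact: mulrC.
  apply: Or33.
  have Pe : P (map_poly polyC (inner_eval b g)).
    have /inner_factor[q gE] : inner_eval b (g - map_poly polyC (inner_eval b g)) = 0.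
      rewrite rmorphB /= /inner_eval -map_poly_comp map_poly_id ?subrr //=.
      by move=> c _ /=; rewrite /horner_eval hornerC.
    by apply: (ideal_subl iP _ Pg); rewrite gE; apply: ideal_mulr.
  have [|a] := prime_poly_root (s := map_poly polyC) prP _ Pe; first exact/eqP.
  by rewrite rmorphB /= map_polyX map_polyC => Pa; exists a, b.
have [all0|/existsNP[g /not_implyP[Pg /eqP g0]]] :=
  pselect (forall g, P g -> g = 0); first by apply: Or31.
apply: Or32.
pose bad n := `[< exists f, [/\ P f, f != 0 & size f = n] >].
have exn : exists n, bad n by exists (size g); apply/asboolP; exists g.
case: (ex_minnP exn) => n /asboolP[f1 [Pf1 f10 f1n]] minn.
pose bad2 m := `[< exists f, [/\ P f, f != 0, size f = n & size (lead_coef f) = m] >].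
have exm : exists m, bad2 m.
  by exists (size (lead_coef f1)); apply/asboolP; exists f1.
case: (ex_minnP exm) => m /asboolP[f [Pf f0 fn fm]] minm.
exists f => // h Ph.
have nz b : inner_eval b f != 0.
  apply/eqP => /inner_factor[f' fE].
  have f'0 : f' != 0 by apply: contra_neq f0 => f'0; rewrite fE f'0 mulr0.
  have Pf' : P f'.
    move: (Pf); rewrite fE => /PM[Pb|//]; case: noC.
    by exists ('X - b%:P); rewrite polyXsubC_eq0.
  have : bad2 (size (lead_coef f')).
    apply/asboolP; exists f'; split=> //.
    by rewrite -fn fE mul_polyC size_scale // polyXsubC_eq0.
  move=> /minm; rewrite -fm fE lead_coefM lead_coefC.
  rewrite size_mul ?polyXsubC_eq0 ?lead_coef_eq0 //.
  by rewrite size_XsubC ltnn.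
have E : (lead_coef f ^+ scalp h f)%:P * h = h %/ f * f + h %% f.
  by rewrite mul_polyC Pdiv.Idomain.divp_eq.
have r0 : h %% f = 0.
  apply: contra_eq (f0) => r0; have : bad (size (h %% f)).
    apply/asboolP; exists (h %% f); split=> //.
    have -> : h %% f = (lead_coef f ^+ scalp h f)%:P * h - h %/ f * f.
      by rewrite E [RHS]addrC addKr.
    by apply: ideal_sub => //; apply: ideal_mull.
  by move=> /minn; rewrite -fn leqNgt Pdiv.Idomain.ltn_modpN0.
rewrite r0 addr0 in E.
by apply: inner_primitive_dvd E; rewrite // expf_neq0 // lead_coef_eq0.
Qed.

End PlanePrimes.

(** * Newton polygons *)

Lemma eval2E (K B : comNzRingType) (c : {rmorphism K -> B}) (a b : B) f :
  eval2 c a b f =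
    \sum_(i < size f) \sum_(j < size f`_i) c f`_i`_j * a ^+ i * b ^+ j.
Proof.
rewrite -{1}[f]coefK poly_def rmorph_sum /=; apply: eq_bigr => i _.
rewrite -mul_polyC rmorphM rmorphXn /= eval2X -{1}[f`_i]coefK poly_def.
rewrite !rmorph_sum mulr_suml /=; apply: eq_bigr => j _.
by rewrite -mul_polyC polyCM polyC_exp rmorphM rmorphXn /= eval2C eval2Y mulrAC.
Qed.

Section NewtonPolygon.
Variable K : closedFieldType.

Lemma nonzero_root (q : {poly K}) b1 b2 :
  b1 != b2 -> q`_b1 != 0 -> q`_b2 != 0 -> exists2 y, y != 0 & q.[y] = 0.
Proof.
move=> b12 q1 q2; have [e [q' q'0 qE]] := multiplicity_XsubC q 0.
rewrite subr0 in qE.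
have q0 : q != 0 by apply: contra_neq q1 => ->; rewrite coef0.
rewrite q0 /= in q'0.
have [/eqP/size_poly1P[c c0 q'E]|/closed_rootP[y q'y]] := eqVneq (size q') 1%N.
  have qn n : q`_n != 0 -> n = e.
    rewrite qE q'E coefCM coefXn; case: (n =P e) => // _.
    by rewrite mulr0 eqxx.
  by move: b12; rewrite (qn _ q1) (qn _ q2) eqxx.
exists y; first by apply: contraNneq q'0 => <-.
by rewrite qE hornerM (rootP q'y) mul0r.
Qed.

Variables (f : {poly {poly K}}) (s t : nat).

Definition weighted : {poly {poly K}} :=
  eval2 (@polyCC K) ('X ^+ s) ('X ^+ t * 'X%:P) f.

Lemma coef_weighted n b : weighted`_n`_b =
  \sum_(i < size f | n == (s * i + t * b)%N) f`_i`_b.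
Proof.
rewrite /weighted eval2E coef_sum coef_sum [RHS]big_mkcond /=.
apply: eq_bigr => i _.
have termE (j : nat) : polyCC (f`_i`_j) * ('X^s) ^+ i * ('X^t * 'X%:P) ^+ j
    = ((f`_i`_j)%:P * 'X^j)%:P * 'X^(s * i + t * j).
  by rewrite /polyCC /= exprMn -!exprM exprD polyCM polyC_exp; ring.
under eq_bigr => j _ do rewrite termE.
rewrite !coef_sum.
have [ltb|leb] := ltnP b (size f`_i); last first.
  rewrite (nth_default _ leb) if_same big1 // => j _.
  rewrite coefCM coefXn; case: (_ == _); last by rewrite mulr0 coef0.
  rewrite mulr1 coefCM coefXn; case: eqP => [bj|]; last by rewrite mulr0.
  by have := ltn_ord j; rewrite -bj ltnNge leb.
rewrite (bigD1 (Ordinal ltb)) //= big1 ?addr0 => [|j jb].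
  rewrite coefCM coefXn; case: (_ == _); last by rewrite mulr0 coef0.
  by rewrite mulr1 coefCM coefXn eqxx mulr1.
rewrite coefCM coefXn; case: (_ == _); last by rewrite mulr0 coef0.
rewrite mulr1 coefCM coefXn; case: eqP => [bj|]; last by rewrite mulr0.
by case/negP: jb; apply/eqP/val_inj; rewrite /= bj.
Qed.

Lemma weighted_factor m :
  (forall a b, f`_a`_b != 0 -> (m <= s * a + t * b)%N) ->
  weighted = 'X^m * drop_poly m weighted.
Proof.
move=> lem; rewrite -{1}[weighted](poly_take_drop m) [RHS]mulrC.
suff -> : take_poly m weighted = 0 by rewrite add0r.
apply/polyP => n; rewrite coef_take_poly coef0; case: ltnP => // ltn.
apply/polyP => b; rewrite coef_weighted coef0 big1 // => i /eqP nE.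
by apply: contraTeq ltn; rewrite nE -leqNgt; apply: lem.
Qed.

Lemma coef_weighted_vertex a b : (0 < s)%N ->
  weighted`_(s * a + t * b)`_b = f`_a`_b.
Proof.
move=> s0; rewrite coef_weighted.
have [lta|lea] := ltnP a (size f); last first.
  rewrite big1 ?(nth_default _ lea) ?coef0 // => i /eqP/addIn/eqP.
  rewrite eqn_pmul2l // => /eqP ai; have := ltn_ord i.
  by rewrite -ai ltnNge lea.
rewrite (bigD1 (Ordinal lta)) //= big1 ?addr0 // => i /andP[/eqP/addIn/eqP].
rewrite eqn_pmul2l // => /eqP ai /negP[]; apply/eqP/val_inj.
by rewrite /= ai.
Qed.

End NewtonPolygon.

(* A polynomial through the origin that is not divisible by a variable has a
   compact edge in its Newton polygon; the weights [s] and [t] are the primitive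
   inner normal of the first edge, seen from the [y]-axis. *)
Lemma newton_edge (K : closedFieldType) (f : {poly {poly K}}) a0 :
  f`_0`_0 = 0 -> f`_0 != 0 -> f`_a0`_0 != 0 ->
  exists s t m (F : {poly {poly K}}) y, [/\ (0 < s)%N, (0 < t)%N, coprime s t,
    y != 0 & [/\ F`_0 != 0, (F`_0).[y] = 0 & weighted f s t = 'X^m * F]].
Proof.
move=> f00 f0 fa0.
have exb : exists b, f`_0`_b != 0.
  by exists (size f`_0).-1; rewrite -lead_coefE lead_coef_eq0.
case: (ex_minnP exb) => b0 fb0 minb.
have b0_gt0 : (0 < b0)%N by case: (b0) fb0 => //; rewrite f00 eqxx.
have lta0 : (a0 < size f)%N.
  by rewrite ltnNge; apply: contra_neqN fa0 => h; rewrite (nth_default _ h) coef0.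
pose T := ('I_(size f) * 'I_b0)%type.
pose v (p : T) : rat := p.1%:R / (b0 - p.2)%:R.
pose p0 : T := (Ordinal lta0, Ordinal b0_gt0).
have [[a1 b1] /= fab1 min1] :=
  @arg_minP _ rat T p0 (fun p => f`_p.1`_p.2 != 0) v fa0.
have ltb1 := ltn_ord b1; have lta1 := ltn_ord a1.
have a1_gt0 : (0 < a1)%N.
  rewrite lt0n; apply: contraTneq ltb1 => a10; rewrite -leqNgt.
  by apply: minb; rewrite -a10.
pose c := (b0 - b1)%N; have c_gt0 : (0 < c)%N by rewrite subn_gt0.
have le1 a b : f`_a`_b != 0 -> (a1 * b0 <= c * a + a1 * b)%N.
  move=> fab; have [leb|ltb] := leqP b0 b.
    by apply: leq_trans (leq_addl _ _); rewrite leq_mul2l leb orbT.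
  have lta : (a < size f)%N.
    by rewrite ltnNge; apply: contra_neqN fab => h; rewrite (nth_default _ h) coef0.
  have := min1 (Ordinal lta, Ordinal ltb) fab; rewrite /v /=.
  rewrite ler_pdivrMr ?ltr0n // mulrAC ler_pdivlMr ?ltr0n ?subn_gt0 //.
  rewrite -!natrM ler_nat -/c => h.
  have -> : (a1 * b0 = a1 * (b0 - b) + a1 * b)%N.
    by rewrite -mulnDr subnK // ltnW.
  by rewrite leq_add2r [(c * a)%N]mulnC.
pose d := gcdn c a1; have d_gt0 : (0 < d)%N by rewrite gcdn_gt0 c_gt0.
pose s := (c %/ d)%N; pose t := (a1 %/ d)%N.
have cE : (c = d * s)%N by rewrite mulnC divnK // dvdn_gcdl.
have a1E : (a1 = d * t :> nat)%N by rewrite mulnC divnK // dvdn_gcdr.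
have s_gt0 : (0 < s)%N by move: c_gt0; rewrite cE muln_gt0 => /andP[].
have t_gt0 : (0 < t)%N by move: a1_gt0; rewrite a1E muln_gt0 => /andP[].
have cop : coprime s t.
  by rewrite /coprime -(eqn_pmul2l d_gt0) muln1 muln_gcdr -cE -a1E.
have lem a b : f`_a`_b != 0 -> (t * b0 <= s * a + t * b)%N.
  by move=> /le1; rewrite a1E cE -!mulnA -mulnDr leq_pmul2l.
have v0 : (t * b0 = s * 0 + t * b0)%N by rewrite muln0.
have v1 : (t * b0 = s * a1 + t * b1)%N.
  apply/eqP; rewrite -(eqn_pmul2l d_gt0) mulnDr !mulnA -cE -a1E [(c * _)%N]mulnC.
  by rewrite -mulnDr subnK // ltnW.
pose F := drop_poly (t * b0)%N (weighted f s t).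
have F0 b : F`_0`_b = (weighted f s t)`_(t * b0)`_b by rewrite coef_drop_poly.
have Fb0 : F`_0`_b0 != 0 by rewrite F0 {1}v0 coef_weighted_vertex.
have Fb1 : F`_0`_b1 != 0 by rewrite F0 v1 coef_weighted_vertex.
have [y y0 Fy] : exists2 y, y != 0 & (F`_0).[y] = 0.
  by apply: (nonzero_root _ Fb1 Fb0); rewrite ltn_eqF.
exists s, t, (t * b0)%N, F, y; split=> //; split=> //.
  by apply: contra_neq Fb0 => ->; rewrite coef0.
exact: weighted_factor.
Qed.

(** * Laurent polynomials and initial forms *)

Section LaurentEval.
Variables (K : fieldType) (n : nat).
Local Notation S := (laurent K n).

Definition wmonom (E : comNzRingType) (N : nat) (u : 'I_n -> E) (nu : 'rV[int]_n) : E :=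
  \prod_m u m ^+ `|(nu 0 m + N%:Z)%R|%N.

Definition evN (D : comNzRingType) (c : {rmorphism K -> D}) N (u : 'I_n -> D)
  (g : S) : D := mmap c (wmonom N u) g.

Definition bounded N (g : S) :=
  forall nu, nu \in msupp g -> forall m, 0 <= nu 0 m + N%:Z.

Lemma bounded_exists g : exists N, bounded N g.
Proof.
exists (\max_(nu <- msupp g) \max_m `|nu 0%R m|)%N => nu nug m.
have : (`|nu 0%R m| <= \max_(nu <- msupp g) \max_m `|nu 0%R m|)%N.
  apply: (@leq_trans (\max_m `|nu 0%R m|)%N); first exact: leq_bigmax.
  by rewrite (big_rem nu) //= leq_max leqnn.
by move: (\max_(nu <- _) _)%N => M; lia.
Qed.

Section Field.
Variables (E : fieldType) (c : {rmorphism K -> E}) (u : 'I_n -> E).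
Hypothesis u0 : forall m, u m != 0.

Definition ev_monom (nu : 'rV[int]_n) : E := \prod_m u m ^ nu 0 m.

Definition lev of (forall m, u m != 0) := fun g : S => mmap c ev_monom g : E.
Local Notation ev := (lev u0).

Lemma ev_monomD nu mu : ev_monom (nu + mu) = ev_monom nu * ev_monom mu.
Proof.
rewrite -big_split; apply: eq_bigr => m _ /=.
by rewrite mxE expfzDr.
Qed.

Lemma evU k nu : ev (<< k *g nu >> : S) = c k * ev_monom nu.
Proof. exact: mmapU. Qed.

Lemma ev_is_zmod_morphism : zmod_morphism ev.
Proof. by move=> f g; apply: mmapB. Qed.
HB.instance Definition _ := GRing.isZmodMorphism.Build S E ev ev_is_zmod_morphism.

Lemma ev_is_monoid_morphism : monoid_morphism ev.
Proof.
split.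
  rewrite -[1]/(lone K n) /lone evU rmorph1 mul1r /ev_monom.
  by rewrite big1 // => m _; rewrite mxE expr0z.
move=> f g; rewrite -[f * g]/(lmul f g) /lmul raddf_sum /=.
rewrite [ev f]mmapE [ev g]mmapE mulr_suml; apply: eq_bigr => nu _.
rewrite raddf_sum mulr_sumr; apply: eq_bigr => mu _.
by rewrite /= evU rmorphM ev_monomD mulrACA.
Qed.
HB.instance Definition _ := GRing.isMonoidMorphism.Build S E ev ev_is_monoid_morphism.

End Field.

Lemma evN_ev (D : comNzRingType) (E : fieldType) (c : {rmorphism K -> D})
    (c' : {rmorphism K -> E}) (s : {rmorphism D -> E}) (u : 'I_n -> D)
    (u0 : forall m, s (u m) != 0) N g :
  s \o c =1 c' -> bounded N g ->
  s (evN c N u g) = lev c' u0 g * s (\prod_m u m) ^+ N.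
Proof.
move=> sc bg; rewrite /evN mmapE rmorph_sum [lev _ _ _]mmapE mulr_suml.
apply: eq_big_seq => nu nug; rewrite rmorphM -sc -mulrA; congr (_ * _).
rewrite !rmorph_prod -prodrXl -big_split /=; apply: eq_bigr => m _.
rewrite rmorphXn /= !exprnP -expfzDr //; congr (_ ^ _).
by rewrite gez0_abs //; apply: bg.
Qed.

End LaurentEval.

Lemma coef0_Xn_cancel (D : idomainType) a b (A B F : {poly D}) :
  F`_0 != 0 -> 'X^a * A = 'X^b * (B * F) -> exists q, A`_0 = q * F`_0.
Proof.
move=> F0; have Xn0 m : 'X^m != 0 :> {poly D} by rewrite monic_neq0 ?monicXn.
have [leab|ltba] := leqP a b.
  rewrite -(subnKC leab) exprD -mulrA => /(mulfI (Xn0 a)) ->.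
  by exists (('X^(b - a))`_0 * B`_0); rewrite !coef0M mulrA.
rewrite -(subnKC (ltnW ltba)) exprD -mulrA => /(mulfI (Xn0 b)).
elim: (a - b)%N B => [|e IH] B.
  by rewrite expr0 mul1r => ->; exists B`_0; rewrite coef0M.
move=> E; have B0 : B`_0 = 0.
  apply/eqP; have := congr1 (fun p : {poly D} => p`_0) E.
  by rewrite exprS -mulrA coefXM coef0M => /esym/eqP; rewrite mulf_eq0 (negPf F0) orbF.
apply: (IH (drop_poly 1 B)); apply: (mulfI (Xn0 1%N)).
rewrite mulrA -exprD E expr1 mulrA ['X * _]mulrC -{1}[B](poly_take_drop 1).
suff -> : take_poly 1 B = 0 by rewrite add0r.
by apply/polyP => -[|i]; rewrite coef_take_poly coef0 //= B0.
Qed.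

Lemma msupp_neq0 (K : fieldType) n (g : laurent K n) :
  g != 0 -> exists nu, nu \in msupp g.
Proof.
move=> g0; apply/fset0Pn; apply: contra_neq g0 => g0.
by rewrite [LHS]monalgE g0 big_seq_fset0.
Qed.

Section InitialForm.
Variables (R : realType) (K : closedFieldType) (w : 'I_4 -> nat).
Local Notation S := (laurent K 4).

Definition weight_vec : 'rV[R]_4 := \row_m (w m)%:R.

Definition wt (nu : 'rV[int]_4) : int := \sum_m (w m)%:Z * nu 0 m.

Lemma dot_weight nu : dot weight_vec nu = (wt nu)%:~R.
Proof.
rewrite /dot /wt rmorph_sum; apply: eq_bigr => m _ /=.
by rewrite mxE rmorphM.
Qed.

Lemma wtD nu mu : wt (nu + mu) = wt nu + wt mu.
Proof.
by rewrite /wt -big_split; apply: eq_bigr => m _; rewrite mxE mulrDr.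
Qed.

Lemma init_formE (g : S) mu : mu \in msupp g ->
  (forall nu, nu \in msupp g -> wt mu <= wt nu) ->
  init_form weight_vec g =
    \sum_(nu <- msupp g | wt nu == wt mu) << g@_nu *g nu >>.
Proof.
move=> mug minmu; rewrite /init_form big_seq_cond [RHS]big_seq_cond.
apply: eq_bigl => nu; case nug : (nu \in msupp g) => //=.
apply/allP/eqP => [h|e la lag].
  have := h _ mug; rewrite !dot_weight ler_int => h'.
  by apply: le_anti; rewrite h' minmu.
by rewrite !dot_weight ler_int e minmu.
Qed.

Lemma min_weight_exists (g : S) : g != 0 -> exists2 mu, mu \in msupp g &
  forall nu, nu \in msupp g -> wt mu <= wt nu.
Proof.
move=> /msupp_neq0[mu0 mu0g].
pose m0 : msupp g := [` mu0g]%fset.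
have [mu _ minmu] := @arg_minP _ int (msupp g) m0 predT (fun nu => wt (val nu)) isT.
exists (val mu); first exact: valP.
by move=> nu nug; apply: (minmu [` nug]%fset).
Qed.

Lemma init_form_init (a b : S) k1 : a != 0 ->
  (forall nu, nu \in msupp a -> wt nu = k1) ->
  (forall nu, nu \in msupp b -> k1 < wt nu) ->
  init_form weight_vec (a + b) = a.
Proof.
move=> a0 wa wb.
have [mu mua] := msupp_neq0 a0.
have dis : [disjoint msupp a & msupp b]%fset.
  apply/fdisjointP => nu nua; apply/negP => /wb.
  by rewrite (wa nu nua) ltxx.
have mug : mu \in msupp (a + b) by rewrite msuppD // inE mua.
rewrite (@init_formE _ mu) //; last first.
  move=> nu; rewrite msuppD // inE (wa mu mua) => /orP[/wa -> //|/wb/ltW //].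
rewrite msuppD // [RHS]monalgE.
rewrite [RHS](big_fset_incl _ (fsubsetUl _ (msupp b))) /=; last first.
  by move=> nu _ /mcoeff_outdom ->; rewrite monalgU0.
rewrite [LHS]big_mkcond; apply: eq_big_seq => nu; rewrite inE mcoeffD (wa mu mua).
case/orP => [nua|nub].
  rewrite (wa nu nua) eqxx (_ : b@_nu = 0) ?addr0 //.
  by apply/mcoeff_outdom/negP => /wb; rewrite (wa nu nua) ltxx.
rewrite (_ : a@_nu = 0); last first.
  by apply/mcoeff_outdom/negP => /wa e; have := wb nu nub; rewrite e ltxx.
by rewrite monalgU0 gt_eqF // wb.
Qed.

End InitialForm.

Section InitialDegeneration.
Variables (R : realType) (K : closedFieldType) (w : 'I_4 -> nat).
Variables (D : idomainType) (c : {rmorphism K -> D}) (U : 'I_4 -> {poly D}).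
Hypothesis U0 : forall m, (U m)`_0 != 0.
Local Notation S := (laurent K 4).

Definition degen (m : 'I_4) : {poly D} := 'X^(w m) * U m.

Lemma degen_neq0 m : tofrac (degen m) != 0.
Proof.
have Um : U m != 0 by apply: contra_neq (U0 m) => ->; rewrite coef0.
by rewrite tofrac_eq0 mulf_neq0 // monic_neq0 // monicXn.
Qed.

Definition degen_consts : {rmorphism K -> {fraction {poly D}}} :=
  [the {rmorphism K -> {fraction {poly D}}} of (@tofrac {poly D}) \o (polyC \o c)].

(* If [g] vanishes, up to units, along the divisor [F] of the family [degen], then
   its initial form vanishes along the special fibre of [F]. *)
Lemma init_form_degen (F : {poly D}) (g : S) N q :
  F`_0 != 0 ->
  lev degen_consts degen_neq0 g * tofrac (\prod_m degen m) ^+ N = tofrac (q * F) ->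
  exists N' M q', bounded N' (init_form (weight_vec R w) g) /\
    evN c N' (fun m => (U m)`_0) (init_form (weight_vec R w) g)
      * (\prod_m (U m)`_0) ^+ M = q' * F`_0.
Proof.
move=> F0 gF; have [g0|gn0] := eqVneq g 0.
  have i0 : init_form (weight_vec R w) g = 0.
    by rewrite /init_form g0 msupp0 big_seq_fset0.
  exists 0%N, 0%N, 0; rewrite i0; split; first by move=> nu; rewrite msupp0.
  by rewrite /evN mmap0 !mul0r.
have [N0 bg] := bounded_exists g.
have [mu mug minmu] := min_weight_exists w gn0.
pose W := (\sum_m w m)%N.
pose H : {poly D} := mmap (polyC \o c)
  (fun nu => 'X^`|(wt w nu - wt w mu)%R| * wmonom N0 U nu) g.
have wtN0 nu : nu \in msupp g -> (0 <= wt w nu + (N0 * W)%N%:Z)%R.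
  move=> nug; have -> : (wt w nu + (N0 * W)%N%:Z = \sum_m (w m)%:Z * (nu 0 m + N0%:Z))%R.
    rewrite /W mulnC big_distrl /= (big_morph Posz PoszD erefl) -big_split /=.
    by apply: eq_bigr => m _; rewrite PoszM mulrDr.
  by apply: sumr_ge0 => m _; apply: mulr_ge0 => //; apply: bg.
pose k := `|(wt w mu + (N0 * W)%N%:Z)%R|%N.
have gH : evN (polyC \o c) N0 degen g = 'X^k * H.
  rewrite /H mmapE /evN mmapE mulr_sumr; apply: eq_big_seq => nu nug.
  rewrite mulrCA; congr (_ * _).
  rewrite /wmonom /degen; under eq_bigr => m _ do rewrite exprMn -exprM.
  rewrite big_split /= mulrA; congr (_ * _).
  rewrite prodrXr -exprD; congr (_ ^+ _).
  apply/eqP; rewrite -eqz_nat (big_morph Posz PoszD erefl) PoszD /k.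
  rewrite !gez0_abs ?wtN0 ?subr_ge0 ?minmu //.
  rewrite addrC addrA subrK.
  apply/eqP; rewrite /W mulnC big_distrl /= (big_morph Posz PoszD erefl) -big_split /=.
  by apply: eq_bigr => m _; rewrite PoszM gez0_abs ?bg // PoszM mulrDr.
have H0 : H`_0 = evN c N0 (fun m => (U m)`_0) (init_form (weight_vec R w) g).
  rewrite (init_formE _ mug minmu) /H mmapE coef_sum /evN.
  rewrite (raddf_sum (mmap c (wmonom N0 (fun m => (U m)`_0)))).
  rewrite [RHS]big_mkcond.
  apply: eq_big_seq => nu nug; rewrite coefCM coef0M coefXn.
  have -> : (wmonom N0 U nu)`_0 = wmonom N0 (fun m => (U m)`_0) nu.
    rewrite -[_`_0]/(coefp 0%N _) rmorph_prod; apply: eq_bigr => m _.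
    by rewrite rmorphXn.
  have [e|ne] := eqVneq (wt w nu) (wt w mu).
    by rewrite e subrr mul1r; apply/esym; apply: mmapU.
  rewrite (_ : _ == _ = false) ?mul0r ?mulr0 //.
  by apply: contra_neqF ne => h; apply/eqP; lia.
have bi : bounded N0 (init_form (weight_vec R w) g).
  move=> nu nui; apply: bg; move: nui; apply: contraLR => nug.
  rewrite -mcoeff_eq0 /init_form raddf_sum big_seq_cond big1 //= => nu' /andP[nu'g _].
  rewrite mcoeffU; case: eqP nug => // <-; by rewrite nu'g.
exists N0, N; have pE : \prod_m degen m = 'X^W * \prod_m U m.
  by rewrite /degen big_split /= prodrXr.
have E : 'X^(k + W * N) * (H * (\prod_m U m) ^+ N) =
         'X^(W * N0) * (q * (\prod_m U m) ^+ N0 * F).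
  apply/eqP; rewrite -tofrac_eq; apply/eqP.
  have e1 := evN_ev (c := [the {rmorphism K -> {poly D}} of polyC \o c])
    (c' := degen_consts) (s := @tofrac {poly D}) degen_neq0 (fun x => erefl) bg.
  have -> : 'X^(k + W * N) * (H * (\prod_m U m) ^+ N) =
     evN (polyC \o c) N0 degen g * (\prod_m degen m) ^+ N.
    by rewrite gH pE exprMn -exprM exprD; ring.
  have -> : 'X^(W * N0) * (q * (\prod_m U m) ^+ N0 * F) =
     q * F * (\prod_m degen m) ^+ N0.
    by rewrite pE exprMn -exprM; ring.
  by rewrite [LHS]rmorphM [RHS]rmorphM /= -gF e1 !rmorphXn mulrAC.
have [q' q'E] := coef0_Xn_cancel F0 E; exists q'; split=> //.
rewrite -q'E coef0M H0; congr (_ * _).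
by rewrite -[RHS]/(coefp 0%N _) rmorphXn rmorph_prod.
Qed.

End InitialDegeneration.

Section DegreeZeroRing.
Variable K : closedFieldType.
Local Notation S := (laurent K 4).
Local Notation S0 := (laurent0 K 4).

Lemma monomM (a b : K) (nu mu : 'rV[int]_4) :
  (<< a *g nu >> : S) * << b *g mu >> = << a * b *g nu + mu >>.
Proof. exact: lmulUU. Qed.

Lemma term_deg0 (a : K) (nu : 'rV[int]_4) :
  degree nu = 0 -> (<< a *g nu >> : S) \in @deg0 K 4.
Proof.
move=> nu0; apply/deg0P => mu mu0; rewrite mcoeffU; case: eqP => // nuE.
by rewrite -nuE nu0 eqxx in mu0.
Qed.

Lemma degree_delta m : @degree 4 (delta_mx 0 m) = 1.
Proof.
rewrite /degree (bigD1 m) //= big1 => [|m' /negPf m'm]; first by rewrite mxE !eqxx addr0.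
by rewrite mxE m'm andbF.
Qed.

Lemma degreeB nu mu : @degree 4 (nu - mu) = degree nu - degree mu.
Proof. by apply/eqP; rewrite eq_sym subr_eq -degreeD subrK. Qed.

Lemma degree0 : @degree 4 0 = 0.
Proof. by rewrite -(subrr 0) degreeB !subrr. Qed.

Definition const0 (a : K) : S0 := Laurent0 (term_deg0 a degree0).

Lemma const0_is_zmod_morphism : zmod_morphism const0.
Proof. by move=> a b; apply: val_inj; apply: monalgUB. Qed.
HB.instance Definition _ :=
  GRing.isZmodMorphism.Build K S0 const0 const0_is_zmod_morphism.
Lemma const0_is_monoid_morphism : monoid_morphism const0.
Proof.
by split=> [|a b]; apply: val_inj => //=; rewrite monomM addr0.
Qed.
HB.instance Definition _ :=
  GRing.isMonoidMorphism.Build K S0 const0 const0_is_monoid_morphism.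

Lemma xratio_deg m n : @degree 4 (delta_mx 0 m - delta_mx 0 n) = 0.
Proof. by rewrite degreeB !degree_delta subrr. Qed.

Definition xratio (m n : 'I_4) : S0 := Laurent0 (term_deg0 1 (xratio_deg m n)).

Lemma xratioM m n p : xratio m n * xratio n p = xratio m p.
Proof.
apply: val_inj; rewrite /= -[LHS]/(lmul _ _) lmulUU mulr1.
by rewrite addrA subrK.
Qed.

Lemma xratiomm m : xratio m m = 1.
Proof. by apply: val_inj; rewrite /= subrr. Qed.

Lemma xratioV m n : xratio m n * xratio n m = 1.
Proof. by rewrite xratioM xratiomm. Qed.

Lemma val_xratioX m n e :
  val (xratio m n ^+ e) = << 1 *g (delta_mx 0 m - delta_mx 0 n) *+ e >>.
Proof.
elim: e => [|e IH]; first by rewrite expr0 mulr0n.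
rewrite exprS mulrS rmorphM /= IH monomM mul1r.
reflexivity.
Qed.

Lemma laurent0_ind (i : 'I_4) (Pr : S0 -> Prop) :
  (forall a, Pr (const0 a)) -> (forall m, Pr (xratio m i)) ->
  (forall m, Pr (xratio i m)) ->
  (forall f g, Pr f -> Pr g -> Pr (f + g)) ->
  (forall f g, Pr f -> Pr g -> Pr (f * g)) -> forall g, Pr g.
Proof.
move=> PC PR PR' PD PM g.
have P1 : Pr 1 by rewrite -(rmorph1 const0).
have P0 : Pr 0 by rewrite -(rmorph0 const0).
have PX f e : Pr f -> Pr (f ^+ e).
  by move=> Pf; elim: e => [|e IH]; rewrite ?expr0 // exprS; apply: PM.
pose M (nu : 'rV[int]_4) : S0 := const0 ((val g)@_nu) *
  \prod_m (if 0 <= nu 0 m then xratio m i else xratio i m) ^+ `|nu 0%R m|%N.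
have -> : g = \sum_(nu <- msupp (val g)) M nu.
  apply: val_inj; rewrite rmorph_sum [LHS]monalgE.
  apply: eq_big_seq => nu nug; rewrite /M rmorphM rmorph_prod.
  pose d m : 'rV[int]_4 := delta_mx 0 m - delta_mx 0 i.
  have prodE (r : seq 'I_4) : \prod_(m <- r)
      val ((if 0 <= nu 0 m then xratio m i else xratio i m) ^+ `|nu 0%R m|%N)
      = << 1 *g \sum_(m <- r) d m *~ nu 0 m >> :> S.
    elim: r => [|m r IH]; first by rewrite !big_nil.
    rewrite !big_cons IH.
    have -> : val ((if 0 <= nu 0 m then xratio m i else xratio i m) ^+ `|nu 0%R m|%N)
        = << 1 *g d m *~ nu 0 m >> :> S.
      case: ifP => [|/negbT]; rewrite -?ltNge => num; rewrite val_xratioX.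
        rewrite -{2}(gez0_abs num); reflexivity.
      rewrite -{2}[nu 0 m]opprK -(ltz0_abs num) mulrNz /d.
      rewrite -mulNrn opprB; reflexivity.
    rewrite monomM mulr1; reflexivity.
  rewrite prodE monomM mulr1 add0r; congr (<< _ *g _ >>).
  under eq_bigr => m _ do rewrite -scaler_int intz scalerBr.
  have nu0 : degree nu = 0.
    by apply/eqP; move: nu nug {prodE}; apply/allP; apply: (valP g).
  rewrite sumrB -row_sum_delta -scaler_suml.
  by rewrite -[\sum_m _]/(degree nu) nu0 scale0r subr0.
apply: (big_ind Pr P0 PD) => nu _; apply: (PM) => //.
apply: (big_ind Pr P1 PM) => m _; apply: PX; by case: ifP.
Qed.

Lemma sum_ratio_L0 (i : 'I_4) : L0 (\sum_m xratio m i).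
Proof.
rewrite /L0 /=.
have -> : val (\sum_m xratio m i) = (<< 1 *g - delta_mx 0 i >> : S) * \sum_m Xvar K m.
  rewrite rmorph_sum mulr_sumr; apply: eq_bigr => m _.
  by rewrite /Xvar /monom monomM mulr1 addrC.
apply: (ideal_mull _ (ideal_genP [set \sum_(i < 4) Xvar K i])).
exact: mem_ideal_gen.
Qed.

Lemma L0_ideal : is_ideal (@L0 K).
Proof.
have [i0 iD iM] := ideal_genP [set \sum_(i < 4) Xvar K i].
split=> [|a b|a b]; rewrite /L0 /=; first exact: i0.
  exact: iD.
exact: iM.
Qed.

Section Evaluation.
Variables (E : fieldType) (c : {rmorphism K -> E}) (u : 'I_4 -> E).
Hypothesis u0 : forall m, u m != 0.

Definition lev0 : S0 -> E := lev c u0 \o val.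
HB.instance Definition _ := GRing.RMorphism.on lev0.

Lemma lev0_const a : lev0 (const0 a) = c a.
Proof.
rewrite /lev0 /= evU /ev_monom big1 ?mulr1 // => m _.
by rewrite mxE expr0z.
Qed.

Lemma ev_monom_delta m : ev_monom u (delta_mx 0 m) = u m.
Proof.
rewrite /ev_monom (bigD1 m) //= big1 => [|m' /negPf m'm].
  by rewrite mxE !eqxx mulr1 expr1z.
by rewrite mxE m'm andbF expr0z.
Qed.

Lemma lev0_ratio m n : lev0 (xratio m n) = u m / u n.
Proof.
rewrite /lev0 /= evU rmorph1 mul1r; apply: (mulIf (u0 n)); rewrite mulfVK //.
by rewrite -{1}(ev_monom_delta n) -ev_monomD // subrK ev_monom_delta.
Qed.

Lemma lev0_L0 g : \sum_m u m = 0 -> L0 g -> lev0 g = 0.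
Proof.
move=> su Lg.
suff : @L K `<=` [set f | lev c u0 f = 0] by apply.
apply: ideal_gen_sub; first by have [] := prime_ker (lev c u0).
move=> _ -> /=; rewrite rmorph_sum -[RHS]su; apply: eq_bigr => m _.
by rewrite [LHS](evU c u0) rmorph1 mul1r ev_monom_delta.
Qed.

End Evaluation.

End DegreeZeroRing.

(** * The affine chart *)

Section Chart.
Variables (K : closedFieldType) (i j k l : 'I_4).
Hypothesis ijkl : uniq [:: i; j; k; l].
Local Notation S0 := (laurent0 K 4).
Local Notation x := (xratio K j i).
Local Notation y := (xratio K k i).
Local Notation z := (xratio K l i).

Lemma mem_ijkl m : m \in [:: i; j; k; l].
Proof.
have [| |_ ->] := uniq_min_size ijkl (s2 := enum 'I_4); last exact: mem_enum.
- by move=> ? _; rewrite mem_enum.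
- by rewrite -cardE card_ord.
Qed.

Lemma big_ijkl (T : Type) (idx : T) (op : Monoid.com_law idx) (F : 'I_4 -> T) :
  \big[op/idx]_m F m = op (F i) (op (F j) (op (F k) (F l))).
Proof.
rewrite (perm_big [:: i; j; k; l]); first by rewrite !big_cons big_nil Monoid.mulm1.
by apply: uniq_perm; rewrite ?index_enum_uniq // => m; rewrite mem_ijkl mem_index_enum.
Qed.

Definition chart : {poly {poly K}} -> S0 := eval2 (@const0 K) x y.
HB.instance Definition _ := GRing.RMorphism.on chart.

Definition third : {poly {poly K}} := - 1 - 'X - 'X%:P.

Lemma chart_third : L0 (z - chart third).
Proof.
have -> : z - chart third = \sum_m xratio K m i.
  rewrite big_ijkl /= xratiomm /chart /third !eval2B eval2N rmorph1 eval2X eval2Y.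
  ring.
exact: sum_ratio_L0.
Qed.

Lemma chart_clear g : exists N G, L0 ((x * y * z) ^+ N * g - chart G).
Proof.
have iL := @L0_ideal K.
have Lz := chart_third.
have L00 a : L0 (a - a : S0) by rewrite subrr; apply: ideal_zero.
pose XYZ : {poly {poly K}} := 'X * 'X%:P * third.
have LX : L0 (x - chart 'X) by rewrite /chart eval2X.
have LY : L0 (y - chart 'X%:P) by rewrite /chart eval2Y.
have LXYZ n : L0 ((x * y * z) ^+ n - chart (XYZ ^+ n)).
  elim: n => [|n IH]; first by rewrite rmorph1.
  rewrite !exprS rmorphM; apply: (ideal_congrM iL) => //.
  rewrite /XYZ !rmorphM; apply: (ideal_congrM iL) => //.
  exact: (ideal_congrM iL).
have cg0 h G : L0 (h - chart G) -> exists N G', L0 ((x * y * z) ^+ N * h - chart G').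
  by move=> h0; exists 0%N, G; rewrite mul1r.
elim/(@laurent0_ind K i): g => [a|m|m|g g'|g g'].
- by apply: (cg0 _ a%:P%:P); rewrite /chart eval2C.
- have := mem_ijkl m; rewrite !inE => /or4P[] /eqP->.
  + by apply: (cg0 _ 1); rewrite rmorph1 xratiomm.
  + exact: cg0 LX.
  + exact: cg0 LY.
  + exact: cg0 Lz.
- have := mem_ijkl m; rewrite !inE => /or4P[] /eqP->.
  + by apply: (cg0 _ 1); rewrite rmorph1 xratiomm.
  + exists 1%N, ('X%:P * third).
    have -> : (x * y * z) ^+ 1 * xratio K i j = x * xratio K i j * (y * z) by ring.
    by rewrite xratioV mul1r rmorphM; apply: (ideal_congrM iL).
  + exists 1%N, ('X * third).
    have -> : (x * y * z) ^+ 1 * xratio K i k = y * xratio K i k * (x * z) by ring.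
    by rewrite xratioV mul1r rmorphM; apply: (ideal_congrM iL).
  + exists 1%N, ('X * 'X%:P).
    have -> : (x * y * z) ^+ 1 * xratio K i l = z * xratio K i l * (x * y) by ring.
    by rewrite xratioV mul1r rmorphM; apply: (ideal_congrM iL).
- move=> [N [G hG]] [M [G' hG']]; exists (N + M)%N, (G * XYZ ^+ M + XYZ ^+ N * G').
  rewrite rmorphD !rmorphM mulrDr; apply: (ideal_congrD iL) => //.
    by rewrite exprD mulrAC; apply: (ideal_congrM iL).
  by rewrite exprD -mulrA; apply: (ideal_congrM iL).
- move=> [N [G hG]] [M [G' hG']]; exists (N + M)%N, (G * G').
  by rewrite exprD mulrACA rmorphM; apply: (ideal_congrM iL).
Qed.

Lemma lev0_chart (E : fieldType) (c : {rmorphism K -> E}) (u : 'I_4 -> E)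
    (u0 : forall m, u m != 0) G :
  lev0 c u0 (chart G) = eval2 c (u j / u i) (u k / u i) G.
Proof.
elim/poly2_ind: G => [e|||f1 g ef eg|f1 g ef eg].
- by rewrite /chart !eval2C lev0_const.
- by rewrite /chart !eval2X lev0_ratio.
- by rewrite /chart !eval2Y lev0_ratio.
- by rewrite !rmorphD /= ef eg.
- by rewrite !rmorphM /= ef eg.
Qed.

End Chart.

Section ChartDegeneration.
Variables (R : realType) (K : closedFieldType) (i j k l : 'I_4).
Hypothesis ijkl : uniq [:: i; j; k; l].
Local Notation S0 := (laurent0 K 4).
Variable P : set S0.
Hypothesis LP : L0 (K:=K) `<=` P.
Hypothesis iP : is_ideal P.
Variables (w : 'I_4 -> nat) (D : idomainType) (c : {rmorphism K -> D}).
Variable U : 'I_4 -> {poly D}.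
Hypothesis U0 : forall m, (U m)`_0 != 0.
Hypotheses (degen_i : degen w U i = 1) (sum_degen : \sum_m degen w U m = 0).
Variables (f : {poly {poly K}}) (F : {poly D}) (m0 : nat).
Hypothesis Pf : forall G, P (chart i j k G) -> exists q, G = q * f.
Hypothesis fF : eval2 [the {rmorphism K -> {poly D}} of polyC \o c]
  (degen w U j) (degen w U k) f = 'X^m0 * F.
Hypothesis F0 : F`_0 != 0.

Lemma chart_divisible g : P g -> exists N q,
  lev (degen_consts c) (degen_neq0 w U0) (val g)
    * tofrac (\prod_m degen w U m) ^+ N = tofrac (q * F).
Proof.
move=> Pg; pose Phi := lev0 (degen_consts c) (degen_neq0 w U0).
have [N [G LG]] := chart_clear ijkl g.
have PG : P (chart i j k G).
  by apply: (ideal_subl iP (LP LG)); apply: ideal_mull.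
have [q Gq] := Pf PG.
have PhiM a b : Phi (a * b) = Phi a * Phi b by apply: rmorphM.
have PhiX a n : Phi (a ^+ n) = Phi a ^+ n by apply: rmorphXn.
have Phi_i : tofrac (degen w U i) = 1 by rewrite degen_i rmorph1.
have PhiE m : Phi (xratio K m i) = tofrac (degen w U m).
  by rewrite /Phi lev0_ratio Phi_i divr1.
have PhiL : Phi ((xratio K j i * xratio K k i * xratio K l i) ^+ N * g)
    = Phi (chart i j k G).
  apply/eqP; rewrite -subr_eq0 -rmorphB; apply/eqP; apply: lev0_L0 => //.
  by rewrite -rmorph_sum sum_degen rmorph0.
exists N, (eval2 [the {rmorphism K -> {poly D}} of polyC \o c]
  (degen w U j) (degen w U k) q * 'X^m0).
rewrite -mulrA -fF -rmorphM -Gq.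
have -> : \prod_m degen w U m = degen w U j * degen w U k * degen w U l.
  by rewrite (big_ijkl ijkl) /= degen_i mul1r mulrA.
have := PhiL; rewrite PhiM PhiX !PhiM !PhiE /chart.
rewrite [Phi (eval2 _ _ _ _)](lev0_chart i j k (degen_consts c) (degen_neq0 w U0)).
rewrite Phi_i !divr1 => e.
have -> : tofrac (eval2 [the {rmorphism K -> {poly D}} of polyC \o c]
    (degen w U j) (degen w U k) G) = eval2 (degen_consts c)
    (tofrac (degen w U j)) (tofrac (degen w U k)) G.
  by apply: (rmorph_eval2 _ _ _ (s := @tofrac {poly D})).
by rewrite -e mulrC; congr (_ * _); rewrite !rmorphM.
Qed.

Lemma init_form_chart g : P g -> exists N M q,
  bounded N (init_form (weight_vec R w) (val g)) /\
  evN c N (fun m => (U m)`_0) (init_form (weight_vec R w) (val g))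
      * (\prod_m (U m)`_0) ^+ M = q * F`_0.
Proof.
by move=> /chart_divisible[N [q e]]; apply: (init_form_degen _ (U0 := U0)) e.
Qed.

Variables (E : fieldType) (s : {rmorphism D -> E}).
Hypothesis sU : forall m, s (U m)`_0 != 0.
Hypothesis sF : s F`_0 = 0.

Definition special_ev : S0 -> E := lev0 [the {rmorphism K -> E} of s \o c] sU.
HB.instance Definition _ := GRing.RMorphism.on special_ev.

Lemma init_ideal_special :
  init_ideal (weight_vec R w) P `<=` [set g | special_ev g = 0].
Proof.
apply: ideal_gen_sub; first by have [] := prime_ker special_ev.
move=> _ [g Pg <-] /=.
have [N [M [q [bN e]]]] := init_form_chart Pg.
have := congr1 s e; rewrite !rmorphM sF mulr0 => /eqP.
rewrite (evN_ev (c' := [the {rmorphism K -> E} of s \o c]) sU (fun _ => erefl) bN).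
have nz : s (\prod_m (U m)`_0) != 0 by rewrite rmorph_prod; apply/prodf_neq0.
rewrite rmorphXn !mulf_eq0 !expf_eq0 (negPf nz) !andbF !orbF => /eqP.
by [].
Qed.

Lemma special_prime : exists Q : set S0,
  prime_ideal Q /\ init_ideal (weight_vec R w) P `<=` Q.
Proof.
by exists [set g | special_ev g = 0]; split; [apply: prime_ker|apply: init_ideal_special].
Qed.

End ChartDegeneration.

Definition at2 (K : comNzRingType) (a b : K) : {poly {poly K}} -> K :=
  eval2 [the {rmorphism K -> K} of idfun] a b.
HB.instance Definition _ K a b := GRing.RMorphism.on (@at2 K a b).

Lemma at2_eval2 (K : comNzRingType) (a b : K) (A B f : {poly {poly K}}) :
  at2 a b (eval2 (@polyCC K) A B f) = at2 (at2 a b A) (at2 a b B) f.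
Proof. by apply: rmorph_eval2 => e; rewrite /= /at2 eval2C. Qed.

Lemma at2E (K : comNzRingType) (a b : K) f : at2 a b f = (f.[a%:P]).[b].
Proof.
elim/poly2_ind: f => [e|||f g ef eg|f g ef eg].
- by rewrite /at2 eval2C !hornerC.
- by rewrite /at2 eval2X hornerX hornerC.
- by rewrite /at2 eval2Y hornerC hornerX.
- by rewrite rmorphD /= ef eg !hornerD.
- by rewrite rmorphM /= ef eg !hornerM.
Qed.

Lemma at2_0l (K : comNzRingType) (b : K) f : at2 0 b f = (f`_0).[b].
Proof. by rewrite at2E polyC0 horner_coef0. Qed.

Lemma at2_third (K : closedFieldType) (a b : K) :
  at2 a b (third K) = - 1 - a - b.
Proof.
by rewrite /third /at2 !eval2B eval2N rmorph1 eval2X eval2Y.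
Qed.

Section ChartPrime.
Variables (R : realType) (K : closedFieldType) (i j k l : 'I_4).
Hypothesis ijkl : uniq [:: i; j; k; l].
Local Notation S0 := (laurent0 K 4).
Variable P : set S0.
Hypothesis LP : L0 (K:=K) `<=` P.
Hypothesis prP : prime_ideal P.

Let iP : is_ideal P. Proof. by case: prP. Qed.

Definition plane_ideal : set {poly {poly K}} := [set G | P (chart i j k G)].

Lemma plane_ideal_prime : prime_ideal plane_ideal.
Proof.
have [_ P1 PM] := prP; split; last by move=> a b; rewrite /plane_ideal /= rmorphM => /PM.
  split; first by rewrite /plane_ideal /= rmorph0; apply: ideal_zero.
    by move=> a b Pa Pb; rewrite /plane_ideal /= rmorphD; apply: ideal_add.
  by move=> a b Pb; rewrite /plane_ideal /= rmorphM; apply: ideal_mull.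
by rewrite /plane_ideal /= rmorph1.
Qed.

Lemma plane_ideal_X : ~ plane_ideal 'X.
Proof.
rewrite /plane_ideal /= /chart eval2X; apply: prime_unit prP _; exact: xratioV.
Qed.

Lemma plane_ideal_Y : ~ plane_ideal 'X%:P.
Proof.
rewrite /plane_ideal /= /chart eval2Y; apply: prime_unit prP _; exact: xratioV.
Qed.

Lemma plane_ideal_third : ~ plane_ideal (third K).
Proof.
move=> Pt; apply: (prime_unit (a := xratio K l i) prP (xratioV _ _ _)).
exact: (ideal_subr iP (LP (chart_third ijkl)) Pt).
Qed.

Lemma generator_not_dvd (f v : {poly {poly K}}) : f != 0 -> plane_ideal f ->
  (forall g, plane_ideal g -> exists q, g = q * f) ->
  ~ plane_ideal v -> (forall q, q * v <> 1) -> forall f', f <> f' * v.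
Proof.
move=> f0 pf gen pv v1 f' fE; have [_ _ pM] := plane_ideal_prime.
have [/gen[q qE]|//] : plane_ideal f' \/ plane_ideal v by apply: pM; rewrite -fE.
have f'0 : f' != 0 by apply: contra_neq f0 => f'0; rewrite fE f'0 mul0r.
apply: (v1 q); apply: (mulIf f'0); rewrite mul1r [RHS]qE [in RHS]fE.
by rewrite mulrAC mulrA.
Qed.

Lemma generator_coef0 (f : {poly {poly K}}) : f != 0 -> plane_ideal f ->
  (forall g, plane_ideal g -> exists q, g = q * f) ->
  f`_0 != 0 /\ inner_eval 0 f != 0.
Proof.
move=> f0 pf gen; split; apply/eqP.
  move=> f00; apply: (@generator_not_dvd f 'X f0 pf gen plane_ideal_X _ (drop_poly 1 f)).
    move=> q /(congr1 (fun p : {poly {poly K}} => p`_0)).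
    by rewrite coefMX coef1 /= => /eqP; rewrite eq_sym oner_eq0.
  rewrite -[LHS](poly_take_drop 1) expr1.
  suff -> : take_poly 1 f = 0 by rewrite add0r.
  by apply/polyP => -[|n]; rewrite coef_take_poly coef0 //= f00.
move=> /inner_factor[g]; rewrite polyC0 subr0 mulrC.
apply: (generator_not_dvd f0 pf gen plane_ideal_Y).
move=> q /(congr1 (inner_eval 0)).
rewrite rmorphM rmorph1 /= inner_evalC hornerX polyC0 mulr0 => /eqP.
by rewrite eq_sym oner_eq0.
Qed.

Lemma chart_generator b :
  (forall G, plane_ideal G -> at2 0 b G = 0) ->
  exists f, [/\ forall G, plane_ideal G -> exists q, G = q * f,
    at2 0 b f = 0, f`_0 != 0 & inner_eval 0 f != 0].
Proof.
move=> van; case: (plane_prime plane_ideal_prime) => [p0|[f [f0 pf] gen]|].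
- exists ('X - ('X - b%:P)%:P); split.
  + by move=> G /p0 ->; exists 0; rewrite mul0r.
  + by rewrite at2_0l coefB coefX coefC /= sub0r hornerN hornerXsubC subrr oppr0.
  + by rewrite coefB coefX coefC /= sub0r oppr_eq0 polyXsubC_eq0.
  + apply/eqP => /(congr1 (fun p : {poly K} => p`_1)).
    rewrite inner_evalB inner_evalC inner_evalX coefB coefX coefC coef0 /= subr0.
    by move/eqP; rewrite oner_eq0.
- have [f00 f0i] := generator_coef0 f0 pf gen.
  by exists f; split=> //; apply: van.
- move=> [a [b' [pa _]]]; have := van _ pa.
  rewrite at2_0l coefB coefX coefC /= sub0r hornerN hornerC => /eqP.
  rewrite oppr_eq0 => /eqP a0; case: plane_ideal_X.
  by move: pa; rewrite a0 !polyC0 subr0.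
Qed.

Definition no_prime (w : 'I_4 -> nat) :=
  forall Q : set S0, prime_ideal Q -> ~ init_ideal (weight_vec R w) P `<=` Q.

Definition sel T (a b c d : T) (m : 'I_4) :=
  if m == i then a else if m == j then b else if m == k then c else d.

Lemma sel_i T (a b c d : T) : sel a b c d i = a.
Proof. by rewrite /sel eqxx. Qed.
Lemma sel_j T (a b c d : T) : sel a b c d j = b.
Proof.
move: ijkl; rewrite /= !inE !negb_or => /andP[/and3P[ij _ _] _].
by rewrite /sel eq_sym (negPf ij) eqxx.
Qed.
Lemma sel_k T (a b c d : T) : sel a b c d k = c.
Proof.
move: ijkl; rewrite /= !inE !negb_or => /and3P[/and3P[_ ik _] /andP[jk _] _].
by rewrite /sel eq_sym (negPf ik) eq_sym (negPf jk) eqxx.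
Qed.
Lemma sel_l T (a b c d : T) : sel a b c d l = d.
Proof.
move: ijkl; rewrite /= !inE !negb_or => /and4P[/and3P[_ _ il] /andP[_ jl] kl _].
by rewrite /sel eq_sym (negPf il) eq_sym (negPf jl) eq_sym (negPf kl).
Qed.

Lemma selP (Pr : 'I_4 -> Prop) : Pr i -> Pr j -> Pr k -> Pr l -> forall m, Pr m.
Proof.
move=> Pi Pj Pk Pl m; have := mem_ijkl ijkl m.
by rewrite !inE => /or4P[] /eqP->.
Qed.

Lemma no_prime_degen (s t r : nat) (Uk Ul f F : {poly {poly K}}) m0 e :
  no_prime (sel 0 s t r)%N ->
  (forall G, plane_ideal G -> exists q, G = q * f) ->
  1 + 'X^s + 'X^t * Uk + 'X^r * Ul = 0 ->
  eval2 (@polyCC K) 'X^s ('X^t * Uk) f = 'X^m0 * F ->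
  F`_0 != 0 -> (F`_0).[e] = 0 -> (Uk`_0).[e] != 0 -> (Ul`_0).[e] != 0 -> False.
Proof.
move=> np gen sum0 fF F0 Fe Uke Ule.
pose w := sel 0%N s t r; pose U := sel (1 : {poly {poly K}}) 1 Uk Ul.
have Ue m : ((U m)`_0).[e] != 0.
  move: m; apply: selP; rewrite /U ?sel_i ?sel_j ?sel_k ?sel_l //;
  by rewrite coef1 /= hornerC oner_neq0.
have U0 m : (U m)`_0 != 0 by apply: contra_neq (Ue m) => ->; rewrite horner0.
have di : degen w U i = 1 by rewrite /degen /w /U !sel_i mul1r.
have dj : degen w U j = 'X^s by rewrite /degen /w /U !sel_j mulr1.
have dk : degen w U k = 'X^t * Uk by rewrite /degen /w /U !sel_k.
have dl : degen w U l = 'X^r * Ul by rewrite /degen /w /U !sel_l.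
have sd : \sum_m degen w U m = 0.
  by rewrite (big_ijkl ijkl) /= di dj dk dl !addrA.
have [|Q [prQ IQ]] := special_prime R ijkl LP iP U0 di sd gen
  (c := @polyC K) (F := F) (m0 := m0) _ F0 (s := horner_eval e) Ue Fe.
  by rewrite dj dk -fF.
exact: np prQ IQ.
Qed.

Lemma off_axis b : no_prime (sel 0 1 0 0)%N -> b != 0 -> b != -1 ->
  exists2 G, plane_ideal G & at2 0 b G != 0.
Proof.
move=> np b0 b1; apply: contrapT => none.
have [|f [gen fb f0 _]] := @chart_generator b.
  by move=> G pG; apply: contrapT => /eqP Gb; apply: none; exists G.
apply: (no_prime_degen (Uk := 'X%:P) (Ul := third K) (F := f) (m0 := 0%N) (e := b)
  np gen) => //.
- by rewrite !expr0 !mul1r expr1 /third; ring.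
- by rewrite !expr0 !mul1r expr1 eval2_id.
- by rewrite -at2_0l.
- by rewrite coefC /= hornerX.
- rewrite /third !coefB coefN coef1 coefX coefC /= subr0 hornerD !hornerN hornerC hornerX.
  by rewrite -opprD oppr_eq0 addrC addr_eq0.
Qed.

Lemma off_origin :
  (forall s t, (0 < s)%N -> (0 < t)%N -> coprime s t -> no_prime (sel 0 s t 0)%N) ->
  exists2 G, plane_ideal G & at2 0 0 G != 0.
Proof.
move=> np; apply: contrapT => none.
have [|f [gen fb f0 fi]] := @chart_generator 0.
  by move=> G pG; apply: contrapT => /eqP Gb; apply: none; exists G.
have [a fa] : exists a, f`_a`_0 != 0.
  apply: contrapT => all0; case/eqP: fi; apply/polyP => a.
  rewrite coef_map coef0 /= /horner_eval horner_coef0.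
  by apply/eqP; apply: contrapT => h; apply: all0; exists a; apply/negP.
have f00 : f`_0`_0 = 0 by rewrite -horner_coef0 -at2_0l.
have [s [t [m [F [y [s0 t0 cop y0 [F0 Fy fF]]]]]]] := newton_edge f00 f0 fa.
apply: (no_prime_degen (Uk := 'X%:P) (Ul := - 1 - 'X^s - 'X^t * 'X%:P)
  (np s t s0 t0 cop) gen _ fF F0 Fy).
- by rewrite expr0 mul1r; ring.
- by rewrite coefC /= hornerX.
- rewrite !coefB coefN coef1 coef0M !coefXn.
  rewrite (ltn_eqF s0) (ltn_eqF t0) /= mul0r !subr0 hornerN hornerC.
  by rewrite oppr_eq0 oner_eq0.
Qed.

End ChartPrime.

(** * The initial ideal along the third line *)

Lemma eval2_congr (K B : comNzRingType) (c : {rmorphism K -> B}) (J : set B)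
    (a b a' b' : B) f : is_ideal J -> J (a - a') -> J (b - b') ->
  J (eval2 c a b f - eval2 c a' b' f).
Proof.
move=> iJ Ja Jb; elim/poly2_ind: f => [e|||f g ef eg|f g ef eg].
- by rewrite !eval2C subrr; apply: ideal_zero.
- by rewrite !eval2X.
- by rewrite !eval2Y.
- by rewrite !rmorphD; apply: ideal_congrD.
- by rewrite !rmorphM; apply: ideal_congrM.
Qed.

Section LineDegeneration.
Variables (R : realType) (K : closedFieldType) (i j k l : 'I_4).
Hypothesis ijkl : uniq [:: i; j; k; l].
Local Notation S0 := (laurent0 K 4).
Local Notation D := {poly {poly K}}.
Local Notation x := (xratio K j i).
Local Notation y := (xratio K k i).
Local Notation z := (xratio K l i).
Variable P : set S0.
Hypothesis LP : L0 (K:=K) `<=` P.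
Hypothesis prP : prime_ideal P.
Variable f : {poly {poly K}}.
Hypothesis pf : P (chart i j k f).
Hypothesis gen : forall G, P (chart i j k G) -> exists q, G = q * f.

Let iP : is_ideal P. Proof. by case: prP. Qed.

Definition line_weight : 'I_4 -> nat := sel i j k 0%N 0%N 0%N 1%N.
Local Notation w := line_weight.
Local Notation I := (init_ideal (weight_vec R w) P).

Definition line_restr : {poly K} := eval2 (@polyC K) 'X (- 1 - 'X) f.
Local Notation h := line_restr.

Definition line_poly : {poly K} -> S0 := chart i j k \o map_poly polyC.
HB.instance Definition _ := GRing.RMorphism.on line_poly.

Lemma line_restrE a : h.[a] = at2 a (- 1 - a) f.
Proof.
rewrite -[h.[a]]/(horner_eval a h) /h.
rewrite (rmorph_eval2 _ _ _ (s := horner_eval a)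
  (c' := [the {rmorphism K -> K} of idfun])).
  by rewrite /= /horner_eval hornerX !hornerE.
by move=> e /=; rewrite /horner_eval hornerC.
Qed.

Definition homog (n : int) (g : S0) :=
  forall nu, nu \in msupp (val g) -> wt w nu = n.

Lemma homogD n g g' : homog n g -> homog n g' -> homog n (g + g').
Proof.
move=> hg hg' nu; rewrite rmorphD => /(fsubsetP (msuppD_le _ _)).
by rewrite inE => /orP[/hg|/hg'].
Qed.

Lemma homogM n n' g g' : homog n g -> homog n' g' -> homog (n + n') (g * g').
Proof.
move=> hg hg' nu; apply: contraTeq => nun.
rewrite -mcoeff_eq0 rmorphM -[_ * _]/(lmul _ _) /lmul.
rewrite raddf_sum big_seq big1 //= => k1 k1g.
rewrite raddf_sum big_seq big1 //= => k2 k2g; rewrite mcoeffU.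
case: eqP => // e; case/eqP: nun.
by rewrite -e wtD (hg _ k1g) (hg' _ k2g).
Qed.

Lemma homog_const a : homog 0 (const0 a).
Proof.
move=> nu /(fsubsetP msuppU_le); rewrite inE => /eqP ->.
by rewrite /wt big1 // => m _; rewrite mxE mulr0.
Qed.

Lemma homog_xratio m n : homog ((w m)%:Z - (w n)%:Z) (xratio K m n).
Proof.
move=> nu /(fsubsetP msuppU_le); rewrite inE => /eqP ->.
have wtd p : wt w (delta_mx 0 p) = (w p)%:Z.
  rewrite /wt (bigD1 p) //= big1 => [|q /negPf qp].
    by rewrite mxE !eqxx mulr1 addr0.
  by rewrite mxE qp andbF mulr0.
by apply/eqP; rewrite eq_sym subr_eq -!wtd -wtD subrK.
Qed.

Lemma homog_chart G : homog 0 (chart i j k G).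
Proof.
elim/poly2_ind: G => [e|||f1 g ef eg|f1 g ef eg].
- by rewrite /chart eval2C; apply: homog_const.
- by rewrite /chart eval2X; have := @homog_xratio j i; rewrite /w (sel_j ijkl) sel_i.
- by rewrite /chart eval2Y; have := @homog_xratio k i; rewrite /w (sel_k ijkl) sel_i.
- by rewrite rmorphD; apply: homogD.
- by rewrite rmorphM -[0]addr0; apply: homogM.
Qed.

Lemma homog_z : homog 1 z.
Proof. by have := @homog_xratio l i; rewrite /w (sel_l ijkl) sel_i. Qed.

Lemma init_ideal_chart A b : homog 1 b -> chart i j k A != 0 ->
  P (chart i j k A + b) -> I (chart i j k A).
Proof.
move=> hb A0 PA; apply: mem_ideal_gen; exists (chart i j k A + b) => //.
apply: val_inj => /=.
apply: (init_form_init R (w := w) (k1 := 0)).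
- by apply: contra_neq A0 => e; apply: val_inj.
- exact: homog_chart.
- by move=> nu /hb ->.
Qed.

Lemma chart_neq0 (G : {poly {poly K}}) (a b : K) :
  a != 0 -> b != 0 -> at2 a b G != 0 -> chart i j k G != 0.
Proof.
move=> a0 b0; apply: contra_neq => G0.
pose u := sel i j k 1 a b 1.
have u0 m : u m != 0.
  by move: m; apply: (selP ijkl);
    rewrite /u ?sel_i ?(sel_j ijkl) ?(sel_k ijkl) ?(sel_l ijkl) ?oner_neq0.
have := lev0_chart i j k [the {rmorphism K -> K} of idfun] u0 G.
by rewrite G0 rmorph0 /u sel_i (sel_j ijkl) (sel_k ijkl) !divr1 => /esym.
Qed.

Lemma init_ideal_third : I (chart i j k (third K)).
Proof.
have iI : is_ideal I by apply: ideal_genP.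
have : I (chart i j k (- third K)).
  apply: (init_ideal_chart homog_z).
    apply: (@chart_neq0 _ 1 (-1)); rewrite ?oppr_eq0 ?oner_eq0 //.
    by rewrite /at2 eval2N [eval2 _ _ _ _]at2_third opprK subrK opprK oner_eq0.
  by rewrite /chart eval2N addrC; apply: LP; apply: chart_third.
by rewrite /chart eval2N => /(ideal_opp iI); rewrite opprK.
Qed.

Lemma line_restr_lift : map_poly polyC h = eval2 (@polyCC K) 'X (- 1 - 'X) f.
Proof.
pose s := [the {rmorphism {poly K} -> {poly {poly K}}} of map_poly polyC].
have sX : s 'X = 'X by apply: map_polyX.
have sY : s (- 1 - 'X) = - 1 - 'X by rewrite (rmorphB s) (rmorphN s) rmorph1 sX.
rewrite -sY -[in RHS]sX; apply: (rmorph_eval2 _ _ _ (s := s)) => e.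
exact: map_polyC.
Qed.

Lemma line_restr_split : exists q, f = map_poly polyC h + third K * q.
Proof.
pose J : set {poly {poly K}} := [set g | exists q, g = third K * q].
have iJ : is_ideal J.
  split; first by exists 0; rewrite mulr0.
    by move=> a b [q ->] [q' ->]; exists (q + q'); rewrite mulrDr.
  by move=> a b [q ->]; exists (a * q); rewrite mulrCA.
have [||q qE] := @eval2_congr _ _ (@polyCC K) J 'X 'X%:P 'X (- 1 - 'X) f iJ.
- by rewrite subrr; exists 0; rewrite mulr0.
- by exists (- 1); rewrite /third; ring.
by exists q; rewrite -qE eval2_id line_restr_lift addrC subrK.
Qed.

Lemma init_ideal_line : h.[-1] != 0 -> I (line_poly h).
Proof.
move=> h1; have [q fE] := line_restr_split.
apply: (@init_ideal_chart _ (z * chart i j k q)).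
- by rewrite -[1]addr0; apply: homogM; [apply: homog_z|apply: homog_chart].
- apply: (@chart_neq0 _ (-1) 1); rewrite ?oppr_eq0 ?oner_eq0 //.
  rewrite at2E -[(-1)%:P]/(polyC (-1)) horner_map /= hornerC.
  exact: h1.
- move: pf; rewrite fE rmorphD rmorphM => pf'.
  have -> : chart i j k (map_poly polyC h) + z * chart i j k q =
    chart i j k (map_poly polyC h) + chart i j k (third K) * chart i j k q
    + (z - chart i j k (third K)) * chart i j k q by ring.
  apply: ideal_add => //; apply: ideal_mulr => //.
  by apply: LP; apply: chart_third.
Qed.

End LineDegeneration.

Section LineFibre.
Variables (R : realType) (K : closedFieldType) (i j k l : 'I_4).
Hypothesis ijkl : uniq [:: i; j; k; l].
Local Notation S0 := (laurent0 K 4).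
Local Notation D := {poly {poly K}}.
Local Notation x := (xratio K j i).
Local Notation y := (xratio K k i).
Local Notation z := (xratio K l i).
Variable P : set S0.
Hypothesis LP : L0 (K:=K) `<=` P.
Hypothesis prP : prime_ideal P.
Variable f : {poly {poly K}}.
Hypothesis pf : P (chart i j k f).
Hypothesis gen : forall G, P (chart i j k G) -> exists q, G = q * f.
Local Notation w := (line_weight i j k).
Local Notation I := (init_ideal (weight_vec R w) P).
Local Notation h := (line_restr f).
Hypothesis h1 : h.[-1] != 0.

Let iP : is_ideal P. Proof. by case: prP. Qed.
Let iI : is_ideal I. Proof. exact: ideal_genP. Qed.

(* The coordinates of the degeneration are [1], [Y], [- 1 - Y - T Z] and [T Z],
   where [D] is the polynomial ring in [Y] over [K[Z]]. *)
Definition line_U : 'I_4 -> {poly D} :=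
  sel i j k 1 'X%:P (- 1 - 'X%:P - 'X * 'X%:P%:P) 'X%:P%:P.

Definition line_V : 'I_4 -> D := sel i j k 1 'X (- 1 - 'X) 'X%:P.

Lemma line_U_coef0 m : (line_U m)`_0 = line_V m.
Proof.
move: m; apply: (selP ijkl); rewrite /line_U /line_V ?sel_i ?(sel_j ijkl)
  ?(sel_k ijkl) ?(sel_l ijkl) ?coefC //.
by rewrite !coefB coefN coef1 coefC coefXM /= subr0.
Qed.

Lemma line_V_neq0 m : line_V m != 0.
Proof.
move: m; apply: (selP ijkl); rewrite /line_V ?sel_i ?(sel_j ijkl)
  ?(sel_k ijkl) ?(sel_l ijkl) ?oner_neq0 ?polyC_eq0 ?polyX_eq0 //.
by rewrite -opprD oppr_eq0 addrC -polyC1 -[1%:P]opprK -polyCN polyXsubC_eq0.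
Qed.

Lemma line_U_neq0 m : (line_U m)`_0 != 0.
Proof. by rewrite line_U_coef0 line_V_neq0. Qed.

Lemma line_degen_i : degen w line_U i = 1.
Proof. by rewrite /degen /line_weight /line_U !sel_i expr0 mul1r. Qed.

Lemma line_degen_j : degen w line_U j = 'X%:P.
Proof. by rewrite /degen /line_weight /line_U !(sel_j ijkl) expr0 mul1r. Qed.

Lemma line_degen_k : degen w line_U k = - 1 - 'X%:P - 'X * 'X%:P%:P.
Proof. by rewrite /degen /line_weight /line_U !(sel_k ijkl) expr0 mul1r. Qed.

Lemma line_degen_l : degen w line_U l = 'X * 'X%:P%:P.
Proof. by rewrite /degen /line_weight /line_U !(sel_l ijkl) expr1. Qed.

Lemma line_degen_sum : \sum_m degen w line_U m = 0.
Proof.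
rewrite (big_ijkl ijkl) /= line_degen_i line_degen_j line_degen_k line_degen_l.
by ring.
Qed.

Definition line_F : {poly D} :=
  eval2 [the {rmorphism K -> {poly D}} of polyC \o (@polyCC K)]
    (degen w line_U j) (degen w line_U k) f.

Lemma line_F_coef0 : line_F`_0 = map_poly polyC h.
Proof.
rewrite line_restr_lift -[LHS]/(coefp 0%N line_F) /line_F.
have c0 e : coefp 0%N (polyCC e)%:P = polyCC e :> D by rewrite /coefp /= coefC.
rewrite (rmorph_eval2 _ _ _ (s := coefp 0%N) (c' := @polyCC K)) //.
rewrite line_degen_j line_degen_k; congr (eval2 _ _ _ _).
  by rewrite /coefp /= coefC.
by rewrite /coefp /= !coefB coefN coef1 coefC coefXM /= subr0.
Qed.

Lemma line_restr_neq0 : h != 0.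
Proof. by apply: contra_neq h1 => ->; rewrite horner0. Qed.

Lemma line_F_neq0 : line_F`_0 != 0.
Proof. by rewrite line_F_coef0 map_polyC_eq0 line_restr_neq0. Qed.

End LineFibre.

Section FibrePoint.
Variables (R : realType) (K : closedFieldType) (i j k l : 'I_4).
Hypothesis ijkl : uniq [:: i; j; k; l].
Local Notation S0 := (laurent0 K 4).
Local Notation D := {poly {poly K}}.
Local Notation x := (xratio K j i).
Local Notation y := (xratio K k i).
Local Notation z := (xratio K l i).
Variable P : set S0.
Hypothesis LP : L0 (K:=K) `<=` P.
Hypothesis prP : prime_ideal P.
Variable f : {poly {poly K}}.
Hypothesis pf : P (chart i j k f).
Hypothesis gen : forall G, P (chart i j k G) -> exists q, G = q * f.
Local Notation w := (line_weight i j k).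
Local Notation I := (init_ideal (weight_vec R w) P).
Local Notation h := (line_restr f).
Hypothesis h1 : h.[-1] != 0.

Let iP : is_ideal P. Proof. by case: prP. Qed.
Let iI : is_ideal I. Proof. exact: ideal_genP. Qed.

Local Notation V := (line_V K i j k).

Section Point.
Variable r : K.
Hypotheses (r0 : r != 0) (r1 : r != -1).

Definition line_spec : {rmorphism D -> {fraction {poly K}}} :=
  [the {rmorphism D -> {fraction {poly K}}} of
     @tofrac {poly K} \o horner_eval r%:P].

Lemma line_specE d : line_spec d = tofrac d.[r%:P].
Proof. by []. Qed.

Lemma line_spec_V_neq0 m : line_spec (V m) != 0.
Proof.
rewrite line_specE tofrac_eq0.
move: m; apply: (selP ijkl); rewrite /line_V ?sel_i ?(sel_j ijkl)
  ?(sel_k ijkl) ?(sel_l ijkl) ?hornerC ?oner_neq0 ?hornerX ?polyC_eq0 ?polyX_eq0 //.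
rewrite hornerD !hornerN hornerX -polyC1 hornerC -polyCN -polyCB polyC_eq0.
by rewrite -opprD oppr_eq0 addrC addr_eq0.
Qed.

Lemma line_spec_U_neq0 m : line_spec (line_U K i j k m)`_0 != 0.
Proof. by rewrite (line_U_coef0 K ijkl) line_spec_V_neq0. Qed.

Definition fibre_ev : S0 -> {fraction {poly K}} :=
  @special_ev K D [the {rmorphism K -> D} of @polyCC K] (line_U K i j k)
    {fraction {poly K}} line_spec line_spec_U_neq0.
HB.instance Definition _ := GRing.RMorphism.on fibre_ev.

Definition fibre : set S0 := [set g | fibre_ev g = 0].

Lemma fibre_prime : prime_ideal fibre.
Proof. exact: prime_ker. Qed.

Lemma fibre_evE g : fibre_ev g =
  lev0 [the {rmorphism K -> {fraction {poly K}}} of line_spec \o @polyCC K]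
    line_spec_V_neq0 g.
Proof.
rewrite /fibre_ev /special_ev /lev0 /= /lev !mmapE; apply: eq_bigr => nu _.
congr (_ * _); apply: eq_bigr => m _.
by rewrite (line_U_coef0 K ijkl).
Qed.

Lemma fibre_const a : fibre_ev (const0 a) = tofrac a%:P.
Proof. by rewrite fibre_evE lev0_const /= /horner_eval hornerC. Qed.

Lemma fibre_x : fibre_ev x = tofrac r%:P.
Proof.
rewrite fibre_evE lev0_ratio !line_specE /line_V sel_i (sel_j ijkl) hornerX.
by rewrite -polyC1 hornerC rmorph1 divr1.
Qed.

Lemma fibre_z : fibre_ev z = tofrac 'X.
Proof.
rewrite fibre_evE lev0_ratio !line_specE /line_V sel_i (sel_l ijkl) hornerC.
by rewrite -polyC1 hornerC rmorph1 divr1.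
Qed.

Hypothesis hr : root h r.

Lemma init_ideal_fibre : I `<=` fibre.
Proof.
have fF : eval2 [the {rmorphism K -> {poly D}} of polyC \o (@polyCC K)]
    (degen w (line_U K i j k) j) (degen w (line_U K i j k) k) f
    = 'X^0 * line_F i j k f by rewrite expr0 mul1r.
have F_r : line_spec (line_F i j k f)`_0 = 0.
  rewrite (line_F_coef0 ijkl) line_specE.
  have -> : (map_poly polyC h).[r%:P] = h.[r]%:P by rewrite horner_map.
  by rewrite (rootP hr) polyC0 rmorph0.
exact: (init_ideal_special ijkl LP iP (line_U_neq0 K ijkl) (line_degen_i K i j k)
  (line_degen_sum K ijkl) gen fF (line_F_neq0 ijkl h1) line_spec_U_neq0 F_r).
Qed.

Definition z_poly : {poly K} -> S0 :=
  horner_morph (commr_rmorph_com (@const0 K) z).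
HB.instance Definition _ := GRing.RMorphism.on z_poly.

Lemma z_polyC a : z_poly a%:P = const0 a.
Proof. exact: horner_morphC. Qed.

Lemma z_polyX : z_poly 'X = z.
Proof. exact: horner_morphX. Qed.

Lemma fibre_z_poly q : fibre_ev (z_poly q) = tofrac q.
Proof.
elim/poly_ind: q => [|q a IH]; first by rewrite !rmorph0.
by rewrite !rmorphD !rmorphM /= IH z_polyX z_polyC fibre_z fibre_const.
Qed.

Lemma fibre_reduce Q : prime_ideal Q ->
  Q (x - const0 r) -> Q (y - const0 (- 1 - r)) ->
  forall g, exists N q, Q (z ^+ N * g - z_poly q).
Proof.
move=> prQ Qx Qy; have [iQ _ _] := prQ.
have Q00 a : Q (a - a) by rewrite subrr; apply: ideal_zero.
have s0 : - 1 - r != 0 by rewrite -opprD oppr_eq0 addrC addr_eq0.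
have inv m a : a != 0 -> Q (xratio K m i - const0 a) ->
    Q (xratio K i m - const0 a^-1).
  move=> a0 Qm.
  have e1 := xratioV K i m.
  have e2 : const0 a * const0 a^-1 = 1 :> S0 by rewrite -rmorphM mulfV // rmorph1.
  have -> : xratio K i m - const0 a^-1 =
      - (xratio K i m * const0 a^-1) * (xratio K m i - const0 a).
    rewrite mulrBr mulNr mulrAC e1 mul1r mulNr -mulrA [const0 a^-1 * _]mulrC e2 mulr1.
    by rewrite opprK addrC.
  exact: ideal_mull.
have cc g a : Q (g - const0 a) -> exists N q, Q (z ^+ N * g - z_poly q).
  by move=> Qg; exists 0%N, a%:P; rewrite expr0 mul1r z_polyC.
elim/(@laurent0_ind K i) => [a|m|m|g g'|g g'].
- exact: cc.
- have := mem_ijkl ijkl m; rewrite !inE => /or4P[] /eqP->.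
  + by apply: (cc _ 1); rewrite rmorph1 xratiomm.
  + exact: cc Qx.
  + exact: cc Qy.
  + by exists 0%N, 'X; rewrite expr0 mul1r z_polyX.
- have := mem_ijkl ijkl m; rewrite !inE => /or4P[] /eqP->.
  + by apply: (cc _ 1); rewrite rmorph1 xratiomm.
  + exact: cc (inv _ _ r0 Qx).
  + exact: cc (inv _ _ s0 Qy).
  + by exists 1%N, 1; rewrite expr1 xratioV rmorph1.
- move=> [N [q hq]] [M [q' hq']]; exists (N + M)%N, (q * 'X^M + 'X^N * q').
  rewrite rmorphD !rmorphM !rmorphXn /= z_polyX mulrDr; apply: ideal_congrD => //.
    by rewrite exprD mulrAC; apply: ideal_congrM.
  by rewrite exprD -mulrA; apply: ideal_congrM.
- move=> [N [q hq]] [M [q' hq']]; exists (N + M)%N, (q * q').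
  by rewrite exprD mulrACA rmorphM; apply: ideal_congrM.
Qed.

Lemma fibre_minimal : minimal_prime I fibre.
Proof.
split; [exact: fibre_prime|exact: init_ideal_fibre|].
move=> Q prQ IQ QF; apply/seteqP; split=> // g; rewrite /fibre /= => g0.
have [iQ _ _] := prQ.
have [b Qb] : exists b, Q (x - const0 b).
  have [|b Qb] := prime_poly_root (s := line_poly i j k) prQ (line_restr_neq0 h1).
    by apply: IQ; apply: (init_ideal_line ijkl LP prP pf h1).
  exists b; move: Qb.
  by rewrite rmorphB /= /line_poly /= map_polyX map_polyC /chart eval2X eval2C.
have br : b = r.
  have := QF _ Qb; rewrite /fibre /= rmorphB /= fibre_x fibre_const => /eqP.
  by rewrite subr_eq0 tofrac_eq => /eqP/polyC_inj.
rewrite br in Qb.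
have Qy : Q (y - const0 (- 1 - r)).
  have Qt := IQ _ (init_ideal_third ijkl LP).
  have -> : y - const0 (- 1 - r) = - (chart i j k (third K)) - (x - const0 r).
    rewrite /chart /third !eval2B eval2N rmorph1 eval2X eval2Y rmorphB rmorphN1.
    by ring.
  by apply: ideal_sub => //; apply: ideal_opp.
have [N [q Qq]] := fibre_reduce prQ Qb Qy g.
have q0 : q = 0.
  have := QF _ Qq; rewrite /fibre /= rmorphB rmorphM /= fibre_z_poly g0 mulr0 sub0r.
  by move=> /eqP; rewrite oppr_eq0 tofrac_eq0 => /eqP.
move: Qq; rewrite q0 rmorph0 subr0 mulrC => /(prime_idealM prQ); apply.
by move=> /(prime_idealX prQ); apply: prime_unit prQ _; apply: xratioV.
Qed.

End Point.
End FibrePoint.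

Section LineMultiplicity.
Variables (R : realType) (K : closedFieldType) (i j k l : 'I_4).
Hypothesis ijkl : uniq [:: i; j; k; l].
Local Notation S0 := (laurent0 K 4).
Local Notation D := {poly {poly K}}.
Local Notation x := (xratio K j i).
Local Notation y := (xratio K k i).
Local Notation z := (xratio K l i).
Variable P : set S0.
Hypothesis LP : L0 (K:=K) `<=` P.
Hypothesis prP : prime_ideal P.
Variable f : {poly {poly K}}.
Hypothesis pf : P (chart i j k f).
Hypothesis gen : forall G, P (chart i j k G) -> exists q, G = q * f.
Local Notation w := (line_weight i j k).
Local Notation I := (init_ideal (weight_vec R w) P).
Local Notation h := (line_restr f).
Hypothesis h1 : h.[-1] != 0.

Let iP : is_ideal P. Proof. by case: prP. Qed.
Let iI : is_ideal I. Proof. exact: ideal_genP. Qed.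

Local Notation V := (line_V K i j k).

Lemma frac_V_neq0 m : tofrac (V m) != 0.
Proof. by rewrite tofrac_eq0 (line_V_neq0 K ijkl). Qed.

Definition frac_consts : {rmorphism K -> {fraction D}} :=
  [the {rmorphism K -> {fraction D}} of @tofrac D \o @polyCC K].

Definition frac_ev : S0 -> {fraction D} :=
  @lev0 K {fraction D} frac_consts (fun m => tofrac (V m)) frac_V_neq0.
HB.instance Definition _ := GRing.RMorphism.on frac_ev.

Let frac_evD a b : frac_ev (a + b) = frac_ev a + frac_ev b.
Proof. exact: (rmorphD [the {rmorphism S0 -> {fraction D}} of frac_ev]). Qed.

Let frac_evM a b : frac_ev (a * b) = frac_ev a * frac_ev b.
Proof. exact: (rmorphM [the {rmorphism S0 -> {fraction D}} of frac_ev]). Qed.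

Let frac_evB a b : frac_ev (a - b) = frac_ev a - frac_ev b.
Proof. exact: (rmorphB [the {rmorphism S0 -> {fraction D}} of frac_ev]). Qed.

Lemma frac_ev_evN (g : S0) N : bounded N (val g) ->
  tofrac (evN [the {rmorphism K -> D} of @polyCC K] N V (val g)) =
  frac_ev g * tofrac (\prod_m V m) ^+ N.
Proof.
move=> bg; apply: (evN_ev (s := [the {rmorphism D -> {fraction D}} of @tofrac D])
  (c' := frac_consts) frac_V_neq0 _ bg) => a.
by [].
Qed.

Lemma frac_ev_x : frac_ev x = tofrac 'X.
Proof.
rewrite /frac_ev lev0_ratio /line_V sel_i (sel_j ijkl).
by rewrite rmorph1 divr1.
Qed.

Lemma frac_ev_const a : frac_ev (const0 a) = tofrac a%:P%:P.
Proof. by rewrite /frac_ev lev0_const. Qed.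

Lemma init_ideal_evN g : P g -> exists N M q,
  [/\ bounded N (val (init0 (weight_vec R w) g)) &
  evN [the {rmorphism K -> D} of @polyCC K] N V (val (init0 (weight_vec R w) g))
    * (\prod_m V m) ^+ M = q * map_poly polyC h].
Proof.
move=> Pg.
have fF : eval2 [the {rmorphism K -> {poly D}} of polyC \o (@polyCC K)]
    (degen w (line_U K i j k) j) (degen w (line_U K i j k) k) f
    = 'X^0 * line_F i j k f by rewrite expr0 mul1r.
have [N [M [q [bN e]]]] := init_form_chart R ijkl LP iP (line_U_neq0 K ijkl)
  (line_degen_i K i j k) (line_degen_sum K ijkl) gen fF (line_F_neq0 ijkl h1) Pg.
exists N, M, q; split=> //.
have UV : (fun m => (line_U K i j k m)`_0) = V.
  by apply/funext => m; apply: (line_U_coef0 K ijkl).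
have pV : \prod_m V m = \prod_m (line_U K i j k m)`_0.
  by apply: eq_bigr => m _; rewrite (line_U_coef0 K ijkl).
by rewrite pV -UV -(line_F_coef0 ijkl).
Qed.

Section DoubleRoot.
Variable r : K.
Hypotheses (r0 : r != 0) (r1 : r != -1).
Variable h2 : {poly K}.
Hypothesis hE : h = h2 * ('X - r%:P) ^+ 2.
Local Notation Xr := ('X - r%:P%:P : D).

Let prodV_neq0 : (\prod_m V m).[r%:P] != 0.
Proof.
rewrite horner_prod; apply/prodf_neq0 => m _.
by rewrite -tofrac_eq0; apply: (line_spec_V_neq0 ijkl r0 r1).
Qed.

(* The initial forms vanish to second order along the fibre over [r]. *)
Definition double_ideal : set S0 := [set g | exists e d : D,
  e.[r%:P] != 0 /\ tofrac e * frac_ev g = tofrac (Xr ^+ 2 * d)].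

Lemma double_ideal_ideal : is_ideal double_ideal.
Proof.
split.
- exists 1, 0; rewrite hornerC oner_neq0; split=> //.
  have -> : frac_ev 0 = 0 by apply: rmorph0.
  by rewrite !mulr0 rmorph0.
- move=> a b [e [d [e0 ed]]] [e' [d' [e'0 ed']]].
  exists (e * e'), (e' * d + e * d'); rewrite hornerM mulf_neq0 //; split=> //.
  have -> : tofrac (e * e') * frac_ev (a + b) =
      tofrac e' * (tofrac e * frac_ev a) + tofrac e * (tofrac e' * frac_ev b).
    by rewrite frac_evD rmorphM; ring.
  rewrite ed ed' -!rmorphM -rmorphD.
  by congr tofrac; ring.
- move=> b a [e [d [e0 ed]]]; have [N bN] := bounded_exists (val b).
  have := frac_ev_evN bN; set dN := evN _ _ _ _ => bE.
  exists (e * (\prod_m V m) ^+ N), (dN * d).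
  rewrite hornerM horner_exp mulf_neq0 ?expf_neq0 //; split=> //.
  have -> : tofrac (e * (\prod_m V m) ^+ N) * frac_ev (b * a) =
      tofrac e * frac_ev a * (frac_ev b * tofrac (\prod_m V m) ^+ N).
    by rewrite frac_evM rmorphM rmorphXn; ring.
  by rewrite ed -bE -rmorphM; congr tofrac; ring.
Qed.

Lemma init_ideal_double : I `<=` double_ideal.
Proof.
apply: (ideal_gen_sub double_ideal_ideal).
move=> _ [g Pg <-]; have [N [M [q [bN e]]]] := init_ideal_evN Pg.
exists ((\prod_m V m) ^+ (N + M)), (q * map_poly polyC h2).
split; first by rewrite horner_exp; apply: expf_neq0.
have -> : Xr ^+ 2 * (q * map_poly polyC h2) = q * map_poly polyC h.
  rewrite hE rmorphM rmorphXn /=.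
  have -> : map_poly polyC ('X - r%:P) = Xr by apply: map_polyXsubC.
  by ring.
rewrite -e [RHS]rmorphM [X in _ = X * _](frac_ev_evN bN) !rmorphXn exprD /=.
by ring.
Qed.

Lemma double_root_fibre u : I (u * (x - const0 r)) -> fibre ijkl r0 r1 u.
Proof.
move=> /init_ideal_double[e [d [e0]]].
have Xr0 : Xr != 0 by rewrite polyXsubC_eq0.
have xr : frac_ev (x - const0 r) = tofrac Xr.
  by rewrite frac_evB frac_ev_x frac_ev_const -rmorphB.
have [N bN] := bounded_exists (val u).
have := frac_ev_evN bN; set dN := evN _ _ _ _ => uE.
rewrite frac_evM xr => E.
have E2 : e * dN = Xr * (d * (\prod_m V m) ^+ N).
  apply: (mulfI Xr0); apply/eqP; rewrite -tofrac_eq; apply/eqP.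
  have -> : Xr * (Xr * (d * (\prod_m V m) ^+ N)) =
    Xr ^+ 2 * d * (\prod_m V m) ^+ N by ring.
  rewrite [RHS]rmorphM /= -E !rmorphM /= uE !rmorphXn /=.
  by ring.
have dN0 : dN.[r%:P] = 0.
  have := congr1 (horner^~ r%:P) E2; rewrite /= !hornerM hornerXsubC subrr mul0r.
  by move=> /eqP; rewrite mulf_eq0 (negPf e0) => /eqP.
rewrite /fibre /= fibre_evE; apply/eqP.
have := evN_ev (s := line_spec r) (c := [the {rmorphism K -> D} of @polyCC K])
  (line_spec_V_neq0 ijkl r0 r1) (fun _ => erefl) bN.
rewrite -/dN !line_specE dN0 rmorph0 => /esym/eqP.
by rewrite mulf_eq0 expf_eq0 tofrac_eq0 (negPf prodV_neq0) andbF orbF.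
Qed.

End DoubleRoot.
End LineMultiplicity.

Section LocalMultiplicity.
Variables (R : realType) (K : closedFieldType) (i j k l : 'I_4).
Hypothesis ijkl : uniq [:: i; j; k; l].
Local Notation S0 := (laurent0 K 4).
Local Notation D := {poly {poly K}}.
Local Notation x := (xratio K j i).
Local Notation y := (xratio K k i).
Local Notation z := (xratio K l i).
Variable P : set S0.
Hypothesis LP : L0 (K:=K) `<=` P.
Hypothesis prP : prime_ideal P.
Variable f : {poly {poly K}}.
Hypothesis pf : P (chart i j k f).
Hypothesis gen : forall G, P (chart i j k G) -> exists q, G = q * f.
Local Notation w := (line_weight i j k).
Local Notation I := (init_ideal (weight_vec R w) P).
Local Notation h := (line_restr f).
Hypothesis h1 : h.[-1] != 0.

Let iP : is_ideal P. Proof. by case: prP. Qed.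
Let iI : is_ideal I. Proof. exact: ideal_genP. Qed.

Local Notation V := (line_V K i j k).

Hypothesis h01 : h.[0] = h.[-1].

Lemma line_root_neq0 r : root h r -> r != 0.
Proof.
by move=> /rootP hr; apply: contra_neq h1 => r0; move: hr; rewrite r0 h01.
Qed.

Lemma line_root_neqN1 r : root h r -> r != -1.
Proof. by move=> /rootP hr; apply: contra_neq h1 => r1; move: hr; rewrite r1. Qed.

Lemma line_fibre_minimal r (hr : root h r) :
  minimal_prime I (fibre ijkl (line_root_neq0 hr) (line_root_neqN1 hr)).
Proof. exact: (fibre_minimal R ijkl LP prP pf gen h1 _ _ hr). Qed.

Lemma fibre_mem r (hr : root h r) a :
  fibre ijkl (line_root_neq0 hr) (line_root_neqN1 hr) (x - const0 a) -> r = a.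
Proof.
rewrite /fibre /= rmorphB /= fibre_x fibre_const => /eqP.
by rewrite subr_eq0 tofrac_eq => /eqP/polyC_inj.
Qed.

Lemma fibre_self r (hr : root h r) :
  fibre ijkl (line_root_neq0 hr) (line_root_neqN1 hr) (x - const0 r).
Proof. by rewrite /fibre /= rmorphB /= fibre_x fibre_const subrr. Qed.

(* [h] takes the same value at [0] and [- 1], so its degree is not [1]. *)
Lemma line_multiplicity (Qs : seq (set S0)) (len : set S0 -> nat) :
  (forall Q, Q \in Qs <-> minimal_prime I Q) ->
  (forall Q, Q \in Qs -> local_length I Q (len Q)) ->
  (\sum_(Q <- Qs) len Q)%N <> 1%N.
Proof.
move=> QsP lenP.
have hN0 : h != 0 by apply: line_restr_neq0 h1.
have len1 Q : Q \in Qs -> (0 < len Q)%N.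
  move=> QQs; have [prQ IQ _] := (QsP Q).1 QQs.
  exact: (local_length_gt0 iI prQ IQ (lenP Q QQs)).
have [/eqP/size_poly1P[c c0 hc]|/closed_rootP[r hr]] := eqVneq (size h) 1%N.
  case: Qs QsP {lenP len1} => [|Q Qs] QsP; first by rewrite big_nil.
  have [[iQ Q1 _] IQ _] := (QsP Q).1 (mem_head _ _); case: Q1.
  have Ih := init_ideal_line ijkl LP prP pf h1.
  have Qc : Q (const0 c).
    by apply: IQ; move: Ih; rewrite hc /line_poly /= map_polyC /chart eval2C.
  have <- : const0 c^-1 * const0 c = 1 :> S0 by rewrite -rmorphM mulVf // rmorph1.
  exact: ideal_mull.
have [g hg] := factor_theorem _ _ hr.
have g0 : g != 0 by apply: contra_neq hN0 => g0; rewrite hg g0 mul0r.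
have [/eqP/size_poly1P[c c0 gc]|/closed_rootP[r' gr']] := eqVneq (size g) 1%N.
  case/eqP: c0; move: h01; rewrite hg gc !hornerM !hornerC !hornerXsubC.
  rewrite mulrBr mulrBr => /addIr/esym; rewrite mulr0 mulrN1 => /eqP.
  by rewrite oppr_eq0 => /eqP.
have [h2 gh2] := factor_theorem _ _ gr'.
have hr' : root h r' by rewrite hg rootM gr'.
pose Q := fibre ijkl (line_root_neq0 hr) (line_root_neqN1 hr).
have QQs : Q \in Qs by apply/QsP; apply: line_fibre_minimal.
rewrite (big_rem Q) //=.
have [rr'|rr'] := eqVneq r r'.
  have hE : h = h2 * ('X - r%:P) ^+ 2.
    by rewrite hg gh2 -rr' -mulrA.
  have [prQ IQ _] := (QsP Q).1 QQs.
  have gt1 : (1 < len Q)%N.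
    apply: (local_length_gt1 iI prQ IQ (fibre_self hr) _ (lenP Q QQs)) => u Iu.
    exact: (double_root_fibre ijkl LP prP gen h1 _ _ hE Iu).
  by move: gt1 => /[swap]; lia.
pose Q' := fibre ijkl (line_root_neq0 hr') (line_root_neqN1 hr').
have Q'Qs : Q' \in Qs by apply/QsP; apply: line_fibre_minimal.
have QQ' : Q' != Q.
  apply: contraNneq rr' => QQ'; apply/eqP.
  by apply: (fibre_mem (hr := hr)); rewrite -/Q -QQ'; apply: fibre_self.
have Q'rem : Q' \in rem Q Qs.
  exact: rem_mem.
rewrite (big_rem Q') //=; have := len1 _ QQs; have := len1 _ Q'Qs; lia.
Qed.

End LocalMultiplicity.

(** * Curves avoiding the vertices and two of the lines *)

Section PlaneCurve.
Variables (R : realType) (K : closedFieldType) (i j k l : 'I_4).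
Hypothesis ijkl : uniq [:: i; j; k; l].
Local Notation S0 := (laurent0 K 4).
Variable P : set S0.
Hypothesis LP : L0 (K:=K) `<=` P.
Hypothesis prP : prime_ideal P.

Let iP : is_ideal P. Proof. by case: prP. Qed.

Local Notation plane := (plane_ideal i j k P).

Lemma plane_ideal_subst (a b : 'I_4) (A B G : {poly {poly K}}) :
  P (xratio K a i - chart i j k A) -> P (xratio K b i - chart i j k B) ->
  plane_ideal i a b P G -> plane (eval2 (@polyCC K) A B G).
Proof.
move=> Pa Pb; rewrite /plane_ideal /= => PG.
have -> : chart i j k (eval2 (@polyCC K) A B G) =
    eval2 (@const0 K) (chart i j k A) (chart i j k B) G.
  pose s := [the {rmorphism {poly {poly K}} -> S0} of chart i j k].
  have sC : s \o @polyCC K =1 @const0 K by move=> e; rewrite /= /chart eval2C.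
  exact: (rmorph_eval2 A B G sC).
exact: ideal_subl iP (eval2_congr _ G iP Pa Pb) PG.
Qed.

Lemma plane_ideal_j : P (xratio K j i - chart i j k 'X).
Proof. by rewrite /chart eval2X subrr; apply: ideal_zero. Qed.

Lemma plane_ideal_k : P (xratio K k i - chart i j k 'X%:P).
Proof. by rewrite /chart eval2Y subrr; apply: ideal_zero. Qed.

Lemma plane_ideal_l : P (xratio K l i - chart i j k (third K)).
Proof. by apply: LP; apply: chart_third. Qed.

Lemma inner_eval_at2 (a b : K) f : (inner_eval b f).[a] = at2 a b f.
Proof.
elim/poly2_ind: f => [e|||f g ef eg|f g ef eg].
- by rewrite /at2 eval2C inner_evalC !hornerC.
- by rewrite /at2 eval2X inner_evalX hornerX.
- by rewrite /at2 eval2Y inner_evalC hornerX hornerC.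
- by rewrite !rmorphD /= hornerD ef eg.
- by rewrite !rmorphM /= hornerM ef eg.
Qed.

Lemma rootless_const (q : {poly K}) : (forall a, q.[a] != 0) ->
  exists2 c, c != 0 & q = c%:P.
Proof.
move=> q0; apply/size_poly1P; apply: contraT => /closed_rootP[a /rootP qa].
by have := q0 a; rewrite qa eqxx.
Qed.

Hypothesis np_jk : forall s t, (0 < s)%N -> (0 < t)%N -> coprime s t ->
  no_prime R P (sel i j k 0 s t 0)%N.
Hypothesis np_jl : forall s t, (0 < s)%N -> (0 < t)%N -> coprime s t ->
  no_prime R P (sel i j l 0 s t 0)%N.
Hypothesis np_kl : forall s t, (0 < s)%N -> (0 < t)%N -> coprime s t ->
  no_prime R P (sel i k l 0 s t 0)%N.
Hypothesis np_j : no_prime R P (sel i j k 0 1 0 0)%N.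
Hypothesis np_k : no_prime R P (sel i k j 0 1 0 0)%N.

Lemma ijlk : uniq [:: i; j; l; k].
Proof.
rewrite (perm_uniq (s2 := [:: i; j; k; l])) // !perm_cons.
by rewrite (perm_catC [:: l] [:: k]).
Qed.

Lemma iklj : uniq [:: i; k; l; j].
Proof.
rewrite (perm_uniq (s2 := [:: i; j; k; l])) // perm_cons.
by rewrite (perm_catC [:: k; l] [:: j]).
Qed.

Lemma ikjl : uniq [:: i; k; j; l].
Proof.
rewrite (perm_uniq (s2 := [:: i; j; k; l])) // perm_cons.
by rewrite (perm_catCA [:: k] [:: j] [:: l]).
Qed.

Lemma plane_off_jk : exists2 G, plane G & at2 0 0 G != 0.
Proof. exact: (off_origin ijkl LP prP np_jk). Qed.

Lemma plane_off_jl : exists2 G, plane G & at2 0 (-1) G != 0.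
Proof.
have [G PG G0] := off_origin ijlk LP prP np_jl.
exists (eval2 (@polyCC K) 'X (third K) G).
  exact: (plane_ideal_subst plane_ideal_j plane_ideal_l PG).
by rewrite at2_eval2 at2_third [at2 0 (-1) 'X]eval2X subr0 opprK addrC subrr.
Qed.

Lemma plane_off_kl : exists2 G, plane G & at2 (-1) 0 G != 0.
Proof.
have [G PG G0] := off_origin iklj LP prP np_kl.
exists (eval2 (@polyCC K) 'X%:P (third K) G).
  exact: (plane_ideal_subst plane_ideal_k plane_ideal_l PG).
by rewrite at2_eval2 at2_third [at2 (-1) 0 _]eval2Y subr0 opprK addrC subrr.
Qed.

Lemma plane_off_j b : b != 0 -> b != -1 -> exists2 G, plane G & at2 0 b G != 0.
Proof. exact: (off_axis ijkl LP prP np_j). Qed.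

Lemma plane_off_k a : a != 0 -> a != -1 -> exists2 G, plane G & at2 a 0 G != 0.
Proof.
move=> a0 a1; have [G PG G0] := off_axis ikjl LP prP np_k a0 a1.
exists (eval2 (@polyCC K) 'X%:P 'X G).
  exact: (plane_ideal_subst plane_ideal_k plane_ideal_j PG).
by rewrite at2_eval2 [at2 a 0 'X]eval2X [at2 a 0 'X%:P]eval2Y.
Qed.

Local Notation I := (init_ideal (weight_vec R (line_weight i j k)) P).

Lemma init_ideal_point a b : plane ('X - a%:P%:P) -> plane ('X - b%:P)%:P -> I 1.
Proof.
move=> Pa Pb; pose c := - 1 - a - b.
have prp := plane_ideal_prime i j k prP.
have [ip _ _] := prp.
have Pc : plane (third K - c%:P%:P).
  have -> : third K - c%:P%:P = - ('X - a%:P%:P) - ('X - b%:P)%:P.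
    by rewrite /third /c !polyCB !polyCN !polyC1; ring.
  by apply: ideal_sub => //; apply: ideal_opp.
have c0 : c != 0.
  apply/eqP => c0; apply: (plane_ideal_third ijkl LP prP).
  by move: Pc; rewrite c0 !polyC0 subr0.
have iI : is_ideal I by apply: ideal_genP.
have cE (e : K) : chart i j k (e%:P%:P) = const0 e by rewrite /chart eval2C.
have : I (chart i j k ((- c)%:P%:P)).
  apply: (init_ideal_chart ijkl (homog_z ijkl)).
    rewrite cE; apply/eqP => /(congr1 (fun g => const0 (- c)^-1 * g)).
    rewrite -rmorphM mulVf ?oppr_eq0 // rmorph1 mulr0 => /eqP.
    by rewrite oner_eq0.
  have -> : chart i j k (- c)%:P%:P + xratio K l i =
      chart i j k (third K - c%:P%:P) + (xratio K l i - chart i j k (third K)).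
    by rewrite /chart eval2B !eval2C rmorphN; ring.
  by apply: ideal_add => //; apply: plane_ideal_l.
rewrite cE => Ic; have <- : const0 (- c)^-1 * const0 (- c) = 1 :> S0.
  by rewrite -rmorphM mulVf ?oppr_eq0 // rmorph1.
exact: (ideal_mull _ iI Ic).
Qed.

Lemma plane_multiplicity (Qs : seq (set S0)) (len : set S0 -> nat) :
  (forall Q, Q \in Qs <-> minimal_prime I Q) ->
  (forall Q, Q \in Qs -> local_length I Q (len Q)) ->
  (\sum_(Q <- Qs) len Q)%N <> 1%N.
Proof.
move=> QsP lenP.
case: (plane_prime (plane_ideal_prime i j k prP)) => [p0|[f [f0 pf] gen]|[a [b [Pa Pb]]]].
- have [G /p0 -> ] := plane_off_jk.
  by rewrite [at2 _ _ _]rmorph0 eqxx.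
- have nz a b : (exists2 G, plane G & at2 a b G != 0) -> at2 a b f != 0.
    move=> [G /gen[q ->]]; rewrite [at2 _ _ _]rmorphM mulf_eq0 negb_or.
    by case/andP.
  have f00 := nz _ _ plane_off_jk.
  have f01 := nz _ _ plane_off_jl.
  have f10 := nz _ _ plane_off_kl.
  have [c c0 fc] : exists2 c, c != 0 & f`_0 = c%:P.
    apply: rootless_const => b; rewrite -at2_0l.
    have [->//|b0] := eqVneq b 0; have [->//|b1] := eqVneq b (-1).
    exact/nz/plane_off_j.
  have [d d0 fd] : exists2 d, d != 0 & inner_eval 0 f = d%:P.
    apply: rootless_const => a; rewrite inner_eval_at2.
    have [->//|a0] := eqVneq a 0; have [->//|a1] := eqVneq a (-1).
    exact/nz/plane_off_k.
  have h0 : (line_restr f).[0] = c by rewrite line_restrE subr0 at2_0l fc hornerC.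
  have h1 : (line_restr f).[-1] = d.
    by rewrite line_restrE opprK addrC subrr -inner_eval_at2 fd hornerC.
  have cd : c = d.
    by have := inner_eval_at2 0 0 f; rewrite fd hornerC at2_0l fc hornerC.
  apply: (line_multiplicity ijkl LP prP pf gen _ _ QsP lenP).
    by rewrite h1.
  by rewrite h0 h1.
- case: Qs QsP {lenP} => [|Q Qs] QsP; first by rewrite big_nil.
  have [[iQ Q1 _] IQ _] := (QsP Q).1 (mem_head _ _).
  by case: Q1; apply: IQ; apply: init_ideal_point Pa Pb.
Qed.

End PlaneCurve.

(** * Rays and multiplicities *)

Section TropicalSide.
Variable R : realType.

Definition weight_class (w : 'I_4 -> nat) : modones int := cls (\row_m (w m)%:Z).

Lemma onesP (A : comNzRingType) (v : 'rV[A]_4) :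
  v \in @ones A -> forall m n, v 0 m = v 0 n.
Proof. by rewrite inE => /eqP -> m n; rewrite !mxE. Qed.

Lemma real_class_cls (v : 'rV[int]_4) :
  real_class R (cls v) = cls (map_mx intr v).
Proof.
apply/eqP; rewrite -clsP -map_mxB.
have : repr (cls v) - v \in @ones int by rewrite clsP clsK.
by rewrite inE => /eqP ->; rewrite inE; apply/eqP/rowP => m; rewrite !mxE.
Qed.

Lemma real_weight_class w : real_class R (weight_class w) = cls (weight_vec R w).
Proof.
by rewrite real_class_cls; congr cls; apply/rowP => m; rewrite !mxE.
Qed.

Lemma weight_vec_relint w : ray_relint (weight_class w) (cls (weight_vec R w)).
Proof. by exists 1; rewrite ?ltr01 // scale1r real_weight_class. Qed.

Lemma primitive_weight_class (w : 'I_4 -> nat) i a b :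
  w i = 0%N -> coprime (w a) (w b) -> primitive (weight_class w).
Proof.
move=> wi cop W d WE.
have WE' : cls (\row_m (w m)%:Z) = cls (repr W *+ d).
  rewrite -[LHS]/(weight_class w) WE.
  elim: d {WE} => [|d IH]; last by rewrite !mulrS clsD clsK IH.
  by rewrite !mulr0n; apply/esym; apply: (raddf0 (\pi_{ideal_quot @ones int})%qT).
have /onesP wE : \row_m (w m)%:Z - repr W *+ d \in @ones int.
  by rewrite clsP WE'.
have dvd m : (d %| w m)%N.
  have := wE m i; rewrite !mxE mulmxnE mulmxnE wi => e.
  pose q : int := repr W 0 m - repr W 0 i.
  have -> : w m = `|(q * d%:Z)%R|%N.
    by move: e; rewrite /q -(mulr_natr (repr W 0 m)) -(mulr_natr (repr W 0 i)) natz; lia.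
  by rewrite abszM dvdn_mull.
by apply/eqP; rewrite -dvdn1 -(eqP cop) dvdn_gcd !dvd.
Qed.

Lemma mult_off_cone (C : tropical_curve R) (i j k l a b : 'I_4) (w : 'I_4 -> nat) :
  uniq [:: i; j; k; l] ->
  curve_support C `<=` cone (unit_class R i) (unit_class R j)
             `|` cone (unit_class R i) (unit_class R k)
             `|` cone (unit_class R i) (unit_class R l) ->
  w i = 0%N -> a != i -> b != i -> a != b -> (0 < w a)%N -> (0 < w b)%N ->
  mult C (weight_class w) = 0%N.
Proof.
move=> ijkl Csub wi ai bi ab wa wb; rewrite /mult; case: ifP => // wC; exfalso.
have Cw : curve_support C (cls (weight_vec R w)).
  exists (weight_class w) => //; exists 1; rewrite ?ler01 //.
  by rewrite scale1r real_weight_class.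
have off c : c != i ->
    ~ cone (unit_class R i) (unit_class R c) (cls (weight_vec R w)).
  move=> ci [al [be [al0 be0]]].
  rewrite /unit_class -[al *: _]/(scale_modones al _) -[be *: _]/(scale_modones be _).
  rewrite !scale_cls -clsD => /eqP; rewrite -clsP => /onesP wE.
  have [a' [a'i a'c wa']] : exists a', [/\ a' != i, a' != c & (0 < w a')%N].
    have [ac|ac] := eqVneq a c; last by exists a.
    by exists b; split=> //; rewrite -ac eq_sym.
  have := wE a' i; rewrite !mxE !eqxx /= (negPf a'i) (negPf a'c) eq_sym.
  rewrite (negPf ci) wi !mulr0 mulr1 !addr0 subr0 sub0r => e.
  have : 0 < (w a')%:R :> R by rewrite ltr0n.
  by rewrite e oppr_gt0 ltNge al0.
move: ijkl; rewrite /= !inE !negb_or => /andP[/and3P[ij ik il] _].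
by case: (Csub _ Cw) => [[]|]; apply: off; rewrite eq_sym.
Qed.

Lemma mult0_no_prime (K : closedFieldType) (P : set (laurent0 K 4)) w :
  curve_trop_mult R P (weight_class w) 0 -> no_prime R P w.
Proof.
move=> Pw Q prQ IQ.
have [Qs [len [_ QsP lenP sum0]]] := Pw _ (weight_vec_relint w).
have [Q' minQ' _] := minimal_prime_exists prQ IQ.
have Q'Qs : Q' \in Qs by apply/QsP.
have [prQ' IQ' _] := minQ'.
have iI : is_ideal (init_ideal (weight_vec R w) P) by apply: ideal_genP.
have := local_length_gt0 iI prQ' IQ' (lenP _ Q'Qs).
by move: sum0; rewrite (big_rem Q') //= => /esym/eqP; rewrite addn_eq0 => /andP[/eqP ->].
Qed.

Lemma unit_class_weight (w : 'I_4 -> nat) a :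
  (forall m, w m = (m == a) :> nat) -> unit_class int a = weight_class w.
Proof.
by move=> wE; congr cls; apply/rowP => m; rewrite !mxE wE; case: (m == a).
Qed.

End TropicalSide.

Theorem proposition5p15 (R : realType) (K : closedFieldType)
    (i j k l : 'I_4) (C : tropical_curve R) :
  [set i; j; k; l]%SET = [set: 'I_4]%SET ->
  curve_support C `<=` cone (unit_class R i) (unit_class R j)
             `|` cone (unit_class R i) (unit_class R k)
             `|` cone (unit_class R i) (unit_class R l) ->
  mult C (unit_class int j) = 0%N ->
  mult C (unit_class int k) = 0%N ->
  realizable K C ->
  mult C (unit_class int l) <> 1%N.
Proof.
move=> setE Csub mj mk [Y Yreal] ml.
have ijkl : uniq [:: i; j; k; l].
  apply/card_uniqP; rewrite -[RHS]/4%N -[RHS](card_ord 4) -cardsT -setE.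
  by apply: eq_card => m; rewrite !inE -!orbA.
move: (ijkl); rewrite /= !inE !negb_or.
move=> /and4P[/and3P[ij ik il] /andP[jk jl] kl _].
have ijlk' := ijlk ijkl; have iklj' := iklj ijkl; have ikjl' := ikjl ijkl.
pose wl := line_weight i j k.
have wlE : unit_class int l = weight_class wl.
  apply: unit_class_weight; apply: (selP ijkl); rewrite /wl /line_weight
    ?sel_i ?(sel_j ijkl) ?(sel_k ijkl) ?(sel_l ijkl) ?eqxx //;
    by rewrite ?(negPf il) ?(negPf jl) ?(negPf kl).
have wjE : unit_class int j = weight_class (sel i j k 0 1 0 0)%N.
  apply: unit_class_weight; apply: (selP ijkl); rewrite
    ?sel_i ?(sel_j ijkl) ?(sel_k ijkl) ?(sel_l ijkl) ?eqxx //;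
    by rewrite ?(negPf ij) // eq_sym ?(negPf jl) ?(negPf jk).
have wkE : unit_class int k = weight_class (sel i k j 0 1 0 0)%N.
  apply: unit_class_weight; apply: (selP ijkl); rewrite
    ?sel_i ?(sel_j ikjl') ?(sel_k ikjl') ?(sel_l ikjl') ?eqxx //;
    by rewrite ?(negPf ik) ?(negPf jk) // eq_sym ?(negPf kl).
have [|mu muP mu1] := Yreal (weight_class wl).
  apply: (@primitive_weight_class _ i l i); first by rewrite /wl /line_weight sel_i.
  by rewrite /wl /line_weight (sel_l ijkl) coprime1n.
rewrite -wlE ml in mu1.
have [a ca] : exists a, (coef a * mu a)%N = 1%N.
  apply: contrapT => none; move: mu1.
  have [a aN0|all0] := pickP (fun a => coef a * mu a != 0)%N; last first.
    by rewrite big1 // => a _; apply/eqP; have /negbFE := all0 a.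
  rewrite (bigD1 a) //= => e; apply: none; exists a.
  by move: aN0 e; case: (coef a * mu a)%N => [|[|n]].
have [prP LP _] := comp_curve a.
have np w b c : w i = 0%N -> coprime (w b) (w c) ->
    mult C (weight_class w) = 0%N -> no_prime R (Defs.comp a) w.
  move=> wi cop m0; apply: mult0_no_prime.
  have [|mu' mu'P] := Yreal (weight_class w).
    exact: primitive_weight_class wi cop.
  rewrite m0 (bigD1 a) //= => /esym/eqP.
  rewrite addn_eq0 muln_eq0 => /andP[/orP[/eqP c0|/eqP mu0] _].
    by move: ca; rewrite c0.
  by rewrite -mu0; apply: mu'P.
have npp (b c d : 'I_4) (u : uniq [:: i; b; c; d]) s t : (0 < s)%N -> (0 < t)%N ->
    coprime s t -> no_prime R (Defs.comp a) (sel i b c 0 s t 0)%N.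
  move=> s0 t0 cop; apply: (np _ b c); rewrite ?sel_i ?(sel_j u) ?(sel_k u) //.
  move: (u); rewrite /= !inE !negb_or => /and3P[/and3P[ib ic _] /andP[bc _] _].
  by apply: (mult_off_cone (a := b) (b := c) ijkl Csub);
    rewrite ?sel_i ?(sel_j u) ?(sel_k u) // eq_sym.
have [|Qs [len [_ QsP lenP sum1]]] := muP a (weight_vec R wl).
  exact: weight_vec_relint.
apply: (plane_multiplicity ijkl LP prP (npp _ _ _ ijkl) (npp _ _ _ ijlk')
  (npp _ _ _ iklj') _ _ QsP lenP).
- by apply: (np _ j j); rewrite ?sel_i ?(sel_j ijkl) // -wjE.
- by apply: (np _ k k); rewrite ?sel_i ?(sel_j ikjl') // -wkE.
- by rewrite -sum1; move/eqP: ca; rewrite muln_eq1 => /andP[_ /eqP].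
Qed.
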